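(* Let $\Bbbk$ be any field, $\delta\in\Bbbk$, $n>1$, $p\in\mathbb N$ and (for the last row) $n\ge1$. Then there are the following Morita equivalences under the stated conditions: $\mathcal P_n(\delta)\simeq_M\Bbbk[\mathcal P^{\le n}(\delta)]$ if $\delta\neq0$; $\mathcal B_n(\delta)\simeq_M\Bbbk[\mathcal B^{\le n}(\delta)]$ if $\delta\ne0$ or $n$ is odd; $J_n(\delta)\simeq_M\Bbbk[J^{\le n}(\delta)]$ if $\delta\ne0$ or $n$ is odd; $\mathrm{TL}_n(\delta)\simeq_M\Bbbk[\mathrm{TL}^{\le n}(\delta)]$ if $\delta\ne0$ or $n$ is odd; $\mathcal B_{p+n,n}(\delta)\simeq_M\Bbbk[{}^p\mathcal B^{\le n}(\delta)]$ if $\delta\ne0$ or $p\ne0$.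
   Context: $\simeq_M$ denotes Morita equivalence (equivalence of the categories of finitely generated left modules). Categories: $\mathcal P(\delta)$ is $\Bbbk$-linear with objects $\mathbb N$, $\mathrm{Hom}(i,j)$ with basis the set partitions of $\{1..i,1'..j'\}$ (bottom row $1..i$, top row $1'..j'$), composition $q\circ p=\delta^{d(p,q)}q\odot p$ where $q\odot p$ is the restriction to $\{1..i,1''..k''\}$ of the partition generated by $p,q$ on $\{1..i,1'..j',1''..k''\}$ and $d(p,q)$ is the number of its blocks contained in $\{1'..j'\}$. $\mathcal B(\delta)$: subcategory spanned by partitions into pairs (Brauer diagrams; propagating lines join the rows, cups/caps join two top/bottom points). $J(\delta)$: Brauer diagrams drawable without crossings with source points on the inner and target points on the outer boundary circle of an annulus. $\mathrm{TL}(\delta)$: Brauer diagrams drawable without crossings between the two rows. ${}^p\mathcal B(\delta)$: objects $p+2\mathbb N$, $\mathrm{Hom}(p+2i,p+2j)$ spanned by Brauer diagrams such that for a vertical wall separating the leftmost $p+i$ bottom and $p+j$ top points from the rightmost $i$ bottom and $j$ top points, no propagating line crosses the wall and each cup and cap crosses it exactly once. Diagram algebras: $\mathcal P_n(\delta)=\mathrm{End}_{\mathcal P(\delta)}(n)$, $\mathcal B_n(\delta)=\mathrm{End}_{\mathcal B(\delta)}(n)$, $J_n(\delta)=\mathrm{End}_{J(\delta)}(n)$, $\mathrm{TL}_n(\delta)=\mathrm{End}_{\mathrm{TL}(\delta)}(n)$, and for $r\ge s\ge1$ the walled Brauer algebra $\mathcal B_{r,s}(\delta)=\mathrm{End}_{{}^{r-s}\mathcal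 B(\delta)}(r+s)$. Truncations: $\mathcal P^{\le n}(\delta)$ is the full subcategory on $\{0,..,n\}$; $\mathcal B^{\le n},J^{\le n},\mathrm{TL}^{\le n}$ the full subcategories on $\{n,n-2,\dots,n-2\lfloor n/2\rfloor\}$; ${}^p\mathcal B^{\le n}(\delta)$ the full subcategory on $\{p,p+2,\dots,p+2n\}$. The category algebra $\Bbbk[\mathcal C]=\bigoplus_{x,y}\mathrm{Hom}_{\mathcal C}(x,y)$ with product given by composition (zero on non-composable pairs). *)

(* Defs.v *)
From HB Require Import structures.
From mathcomp Require Import all_boot all_order all_algebra.
Set Implicit Arguments. Unset Strict Implicit. Unset Printing Implicit Defensive.
Import GRing.Theory.

(* Finite-dimensional unital K-algebras given by a basis and structure       *)
(* constants:  x * y = \sum_z fd_mul x y z *: z,   1 = \sum_z fd_one z *: z. *)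
Section Morita.
Variable K : fieldType.

Record fdalg := FdAlg {
  fd_basis : finType;
  fd_mul : fd_basis -> fd_basis -> fd_basis -> K;
  fd_one : fd_basis -> K }.

(* A finite-dimensional (= finitely generated, the algebra being f.d.)      *)
(* unital left module, given in a basis: a representation x |-> mact x,     *)
(* acting on column vectors.                                                *)
Record fdmod (A : fdalg) := FdMod { md : nat; mact : fd_basis A -> 'M[K]_md }.

Definition is_module (A : fdalg) (M : fdmod A) : Prop :=
  (forall x y : fd_basis A,
      (mact M x *m mact M y = \sum_z fd_mul x y z *: mact M z)%R) /\
  (\sum_z @fd_one A z *: mact M z = (1%:M)%R)%R.

Definition modobj (A : fdalg) := {M : fdmod A | is_module M}.

Definition is_hom (A : fdalg) (M N : modobj A)
    (f : 'M[K]_(md (sval N), md (sval M))) : Prop :=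
  forall x, (f *m mact (sval M) x = mact (sval N) x *m f)%R.

Definition modhom (A : fdalg) (M N : modobj A) := {f | @is_hom A M N f}.

Record mfunctor (A B : fdalg) := MFunctor {
  fobj : modobj A -> modobj B;
  fmap : forall M N : modobj A, modhom M N -> modhom (fobj M) (fobj N);
  fmap_id : forall M (h : modhom M M), sval h = (1%:M)%R -> sval (fmap h) = (1%:M)%R;
  fmap_comp : forall M N L (f : modhom M N) (g : modhom N L) (h : modhom M L),
      sval h = (sval g *m sval f)%R -> sval (fmap h) = (sval (fmap g) *m sval (fmap f))%R }.

Definition nat_iso_id (A B : fdalg) (F : mfunctor A B) (G : mfunctor B A) : Prop :=
  exists eta : forall M : modobj A, 'M[K]_(md (sval (fobj G (fobj F M))), md (sval M)),
    [/\ (forall M, @is_hom A M (fobj G (fobj F M)) (eta M)),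
        (forall M, exists g : 'M[K]_(md (sval M), md (sval (fobj G (fobj F M)))),
            (g *m eta M = (1%:M)%R)%R /\ (eta M *m g = (1%:M)%R)%R) &
        (forall M N (f : modhom M N),
            (eta N *m sval f = sval (fmap G (fmap F f)) *m eta M)%R)].

Definition morita_equiv (A B : fdalg) : Prop :=
  exists (F : mfunctor A B) (G : mfunctor B A), nat_iso_id F G /\ nat_iso_id G F.

End Morita.

(* Set-partition diagrams.  A diagram a -> b is a set partition of the      *)
(* points {x : 'I_N | x < a + b}; x < a is the bottom point x+1, and        *)
(* a <= x < a + b is the top point (x-a+1)'.  N is a global bound >= a + b.  *)
Section Diagrams.
Variable N : nat.
Implicit Types P Q : {set {set 'I_N}}.

Definition is_diag (a b : nat) P := partition P [set x : 'I_N | x < a + b].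

Definition blk P (x y : nat) : bool :=
  [exists B in P, [exists u in B, [exists v in B, (val u == x) && (val v == y)]]].

(* P : i -> j, Q : j -> k, glued on the points {1..i,1'..j',1''..k''} = 'I_(i+j+k) *)
Definition glue_rel (i j k : nat) P Q : rel 'I_(i + j + k) := fun x y =>
  [&& x < i + j, y < i + j & blk P x y] || [&& i <= x, i <= y & blk Q (x - i) (y - i)].

Definition emb (i j u : nat) : nat := if u < i then u else u + j.

Definition glue_conn i j k P Q (x y : nat) : bool :=
  [exists a : 'I_(i + j + k), [exists b : 'I_(i + j + k),
     [&& val a == x, val b == y & connect (@glue_rel i j k P Q) a b]]].

Definition dcomp i j k P Q : {set {set 'I_N}} :=
  equivalence_partition
    (fun u v : 'I_N => glue_conn i j k P Q (emb i j u) (emb i j v))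
    [set u : 'I_N | u < i + k].

Definition dloops i j k P Q : nat :=
  #|[set B in equivalence_partition (connect (@glue_rel i j k P Q)) [set: 'I_(i + j + k)]
     | [forall x in B, (i <= x) && (x < i + j)]]|.

Definition idpart (a : nat) : {set {set 'I_N}} :=
  [set [set x : 'I_N | (val x == val k) || (val x == a + val k)] | k in [set k : 'I_N | k < a]].

Definition brauerb P : bool := [forall B in P, #|B| == 2].

(* position of a point when going around the boundary of the rectangle:   *)
(* bottom row left to right, then top row right to left                   *)
Definition pos (a b x : nat) : nat := if x < a then x else a + (b.-1 - (x - a)).

Definition noncrossing (f : nat -> nat) P : bool :=
  [forall B1 in P, forall B2 in P, forall x1 in B1, forall y1 in B1,
     forall x2 in B2, forall y2 in B2,
     ~~ [&& f x1 < f x2, f x2 < f y1 & f y1 < f y2]].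

Definition tlb (a b : nat) P : bool := brauerb P && noncrossing (pos a b) P.

(* rotating the bottom (inner circle) points by r and the top (outer      *)
(* circle) points by s                                                    *)
Definition rot (a b r s x : nat) : nat :=
  if x < a then (x + r) %% a else a + ((x - a + s) %% b).

(* Jones annular: planar in the annulus = planar after cutting the annulus *)
(* along suitable radii, i.e. TL-planar after rotating both circles.      *)
Definition jonesb (a b : nat) P : bool :=
  brauerb P && [exists r : 'I_N.+1, exists s : 'I_N.+1,
                  noncrossing (fun x => pos a b (rot a b r s x)) P].

(* walled Brauer in  Hom(p+2i, p+2j) of  ^pB *)
Definition walledb (p a b : nat) P : bool :=
  let i := (a - p)./2 in let j := (b - p)./2 in
  let left (x : nat) := if x < a then x < p + i else x - a < p + j in
  brauerb P &&
  [forall B in P, forall x in B, forall y in B,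
     (x != y) ==> (if (x < a) == (y < a) then left x != left y else left x == left y)].

End Diagrams.

(* Category algebra of the full subcategory with objects objs of a diagram   *)
(* category whose Hom(a,b) is spanned by the diagrams a -> b satisfying      *)
(* allowed; composition q o p = delta^d(p,q) (q (.) p), product = composition.*)
Section CatAlg.
Variable K : fieldType.
Variable delta : K.
Variable objs : seq nat.
Variable allowed : forall N : nat, nat -> nat -> {set {set 'I_N}} -> bool.

Definition Nof : nat := (foldr maxn 0 objs).*2.
Local Notation NN := Nof.

Definition cbasis_pred (t : 'I_NN.+1 * 'I_NN.+1 * {set {set 'I_NN}}) : bool :=
  let: (a, b, P) := t in
  [&& (a : nat) \in objs, (b : nat) \in objs, is_diag a b P & allowed a b P].

Definition cbasis : finType := {t : 'I_NN.+1 * 'I_NN.+1 * {set {set 'I_NN}} | cbasis_pred t}.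

Definition cmul (x y z : cbasis) : K :=
  let: (b, c, Q) := val x in let: (a, b', P) := val y in let: (a', c', R) := val z in
  if [&& (b == b' :> nat), (a' == a :> nat), (c' == c :> nat) & R == dcomp a b c P Q]
  then (delta ^+ dloops a b c P Q)%R else 0%R.

Definition cone (z : cbasis) : K :=
  let: (a, b, R) := val z in
  if (a == b :> nat) && (R == idpart NN a) then 1%R else 0%R.

Definition cat_alg : fdalg K := FdAlg cmul cone.

End CatAlg.

Definition part_allowed (N : nat) (a b : nat) (P : {set {set 'I_N}}) : bool := true.
Definition brauer_allowed (N : nat) (a b : nat) (P : {set {set 'I_N}}) := brauerb P.
Definition tl_allowed (N : nat) (a b : nat) (P : {set {set 'I_N}}) := tlb a b P.
Definition jones_allowed (N : nat) (a b : nat) (P : {set {set 'I_N}}) := jonesb a b P.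
Definition walled_allowed (p : nat) (N : nat) (a b : nat) (P : {set {set 'I_N}}) :=
  walledb p a b P.

Definition objs_le (n : nat) : seq nat := iota 0 n.+1.
Definition objs_par (n : nat) : seq nat := [seq n - 2 * k | k <- iota 0 (n./2).+1].
Definition objs_walled (p n : nat) : seq nat := [seq p + 2 * k | k <- iota 0 n.+1].

Definition Palg (K : fieldType) (d : K) n := cat_alg d [:: n] part_allowed.
Definition Balg (K : fieldType) (d : K) n := cat_alg d [:: n] brauer_allowed.
Definition Jalg (K : fieldType) (d : K) n := cat_alg d [:: n] jones_allowed.
Definition TLalg (K : fieldType) (d : K) n := cat_alg d [:: n] tl_allowed.
(* walled Brauer algebra B_{r,s} = End_{^{r-s}B}(r+s), r >= s >= 1 *)
Definition WBalg (K : fieldType) (d : K) r s := cat_alg d [:: r + s] (walled_allowed (r - s)).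

Definition Pcat_le (K : fieldType) (d : K) n := cat_alg d (objs_le n) part_allowed.
Definition Bcat_le (K : fieldType) (d : K) n := cat_alg d (objs_par n) brauer_allowed.
Definition Jcat_le (K : fieldType) (d : K) n := cat_alg d (objs_par n) jones_allowed.
Definition TLcat_le (K : fieldType) (d : K) n := cat_alg d (objs_par n) tl_allowed.
Definition WBcat_le (K : fieldType) (d : K) p n := cat_alg d (objs_walled p n) (walled_allowed p).

(* Main.v *)
Require Import Defs.
From mathcomp Require Import all_boot all_order all_algebra zify.
Set Implicit Arguments. Unset Strict Implicit. Unset Printing Implicit Defensive.
Import GRing.Theory.

(* Let [B] be the algebra of the truncated category, and [A] the endomorphism
   algebra of its largest object [n].  Every object [m] is a retract of [n] up
   to an invertible scalar: [v_m u_m = delta^k id_m], where [u_m] adds cups (or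
   singletons) to the identity of [m] and [v_m] adds caps; when [delta = 0] the
   caps are shifted by one strand with respect to the cups, so that composing
   straightens a zigzag and creates no loop ([k = 0]).  Restriction
   [M |-> id_n M] is then an equivalence, with inverse
   [M |-> (+)_m delta^-k (u_m v_m) M] on which [f : m -> m'] acts through
   [u_m' f v_m].  The diagram [u_m' f v_m] is [f] drawn on longer rows with
   extra blocks, so that one theorem on the composition of such extended
   diagrams gives all the relations; and since an extended diagram is allowed
   exactly when [f] is, neither associativity of the composition nor stability
   of the diagram classes under composition is needed. *)

(** * Morita equivalence from retracts *)

(** Modules are given in coordinates, by square matrices, so a subspace such as the image of [id_n]
    is not yet a module of the required form: it must first be given a basis. Hence both functors
    use one device, cutting the image of an idempotent [E] out of a representation that need not be
    unital, through a factorization [E = C R] with [R C = 1]. Algebras likewise have structure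
    constants but no elements, so the relations enter as products of two basis elements, each being
    a scalar times a basis element or zero.

    The conditions on delta, n and p come from the choice of [u_m] and [v_m]. With unshifted caps
    every added block closes a loop, and delta has to be invertible. A shifted row needs a strand to
    straighten, hence at least one strand on every object: n odd provides it for the Brauer, annular
    and planar classes, and p nonzero for the walled class, where the strand taken is the last one
    left of the wall. *)

Section CutMorita.
Local Open Scope ring_scope.
Variable K : fieldType.

(** A rank factorization of [E]: in [C R C R = C R] the left factor [C] has a left inverse and the
    right factor [R] a right inverse, and cancelling them leaves [R C = 1]. The result lives in
    [Type] because the rank and both factors enter later definitions. *)
Lemma idempotent_factor D (E : 'M[K]_D) : E *m E = E ->
  {r : nat & {CR : 'M_(D, r) * 'M_(r, D) | CR.1 *m CR.2 = E & CR.2 *m CR.1 = 1%:M}}.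
Proof.
move=> EE; exists (\rank E), (col_base E, row_base E) => /=; first exact: mulmx_base.
have /row_fullP[L LC] := col_base_full E.
have /row_freeP[R RR] := row_base_free E.
have CRCR : col_base E *m row_base E *m (col_base E *m row_base E)
    = col_base E *m row_base E by rewrite mulmx_base.
move: (col_base E) (row_base E) LC RR CRCR => C R0 LC RR CRCR.
have := congr1 (fun X => L *m X *m R) CRCR.
by rewrite /= !mulmxA LC mul1mx -!mulmxA RR mulmx1.
Qed.

(** * Non-unital representations and the modules cut out by their units *)

Section Prerep.
Variable B : fdalg K.

Definition unit_op D (T : fd_basis B -> 'M[K]_D) : 'M[K]_D :=
  \sum_z @fd_one K B z *: T z.

(* A representation of [B] that need not be unital: the unit acts as an
   idempotent, and [cut] is the module carried by its image. *)
Record prerep := Prerep {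
  pdim : nat;
  pact : fd_basis B -> 'M[K]_pdim;
  pactM : forall x y, pact x *m pact y = \sum_z fd_mul x y z *: pact z;
  pact1l : forall x, unit_op pact *m pact x = pact x;
  pact1r : forall x, pact x *m unit_op pact = pact x }.

Variable P : prerep.
Let E := unit_op (@pact P).

Lemma unit_op_idem : E *m E = E.
Proof.
by rewrite {2}/E mulmx_sumr; apply: eq_bigr => z _; rewrite -scalemxAr pact1l.
Qed.

Let rCR := idempotent_factor unit_op_idem.
Definition cut_dim : nat := tag rCR.
Definition cutC : 'M[K]_(pdim P, cut_dim) := (s2val (tagged rCR)).1.
Definition cutR : 'M[K]_(cut_dim, pdim P) := (s2val (tagged rCR)).2.

Lemma cutCR : cutC *m cutR = E. Proof. exact: (s2valP (tagged rCR)). Qed.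
Lemma cutRC : cutR *m cutC = 1%:M. Proof. exact: (s2valP' (tagged rCR)). Qed.
Lemma cutRE : cutR *m E = cutR.
Proof. by rewrite -cutCR mulmxA cutRC mul1mx. Qed.

Definition cut_mod : fdmod B :=
  @FdMod K B cut_dim (fun x => cutR *m pact P x *m cutC).

(** Between two actions the factor [C R] is the unit [E], which every action absorbs. *)
Lemma cut_is_module : is_module cut_mod.
Proof.
split=> [x y|] /=.
  rewrite !mulmxA -[_ *m cutC *m cutR]mulmxA cutCR -[_ *m E]mulmxA pact1r.
  rewrite -[cutR *m _ *m _]mulmxA pactM mulmx_sumr mulmx_suml.
  by apply: eq_bigr => z _; rewrite -scalemxAr -scalemxAl.
transitivity (cutR *m E *m cutC); last by rewrite cutRE cutRC.
rewrite mulmx_sumr mulmx_suml.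
by apply: eq_bigr => z _; rewrite -scalemxAr -scalemxAl.
Qed.

Definition cut : modobj B := exist _ cut_mod cut_is_module.

End Prerep.

(** An intertwiner respects the images of the units, which is what lets it be cut at both ends. *)
Lemma prerep_hom_unit B (P Q : prerep B) (f : 'M[K]_(pdim Q, pdim P)) :
  (forall x, f *m pact P x = pact Q x *m f) ->
  f *m unit_op (pact P) = unit_op (pact Q) *m f.
Proof.
move=> hf; rewrite mulmx_sumr mulmx_suml.
by apply: eq_bigr => z _; rewrite -scalemxAr -scalemxAl hf.
Qed.

Lemma cut_is_hom B (P Q : prerep B) (f : 'M[K]_(pdim Q, pdim P)) :
  (forall x, f *m pact P x = pact Q x *m f) ->
  @is_hom K B (cut P) (cut Q) (cutR Q *m f *m cutC P).
Proof.
move=> hf x /=.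
rewrite !mulmxA -[_ *m cutC P *m cutR P]mulmxA cutCR.
rewrite -[_ *m cutC Q *m cutR Q]mulmxA cutCR.
rewrite -[cutR Q *m f *m _]mulmxA prerep_hom_unit // mulmxA cutRE.
by rewrite -[cutR Q *m _ *m unit_op _]mulmxA pact1r -[_ *m f *m _]mulmxA hf !mulmxA.
Qed.

Section CutFunctor.
Variables (A B : fdalg K) (P : modobj A -> prerep B).
Variable Phi : forall M N : modobj A,
  'M[K]_(md (sval N), md (sval M)) -> 'M[K]_(pdim (P N), pdim (P M)).
Hypothesis Phi1 : forall M, @Phi M M 1%:M = 1%:M.
Hypothesis PhiM : forall (M N L : modobj A)
  (f : 'M[K]_(md (sval N), md (sval M))) (g : 'M[K]_(md (sval L), md (sval N))),
  @Phi M L (g *m f) = @Phi N L g *m @Phi M N f.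
Hypothesis Phi_hom : forall (M N : modobj A) (f : 'M[K]_(md (sval N), md (sval M))),
  is_hom f -> forall x, @Phi M N f *m pact (P M) x = pact (P N) x *m @Phi M N f.

(** [Phi] is defined and multiplicative on all matrices, and is asked to give intertwiners only on
    homomorphisms; the functor laws thus become plain matrix identities. *)
Definition cut_fmap (M N : modobj A) (f : modhom M N) : modhom (cut (P M)) (cut (P N)) :=
  exist _ (cutR (P N) *m @Phi M N (sval f) *m cutC (P M)) (cut_is_hom (Phi_hom (proj2_sig f))).

Lemma cut_fmap_id M (h : modhom M M) :
  sval h = 1%:M -> sval (cut_fmap h) = 1%:M.
Proof. by move=> /= ->; rewrite Phi1 mulmx1 cutRC. Qed.

Lemma cut_fmap_comp M N L (f : modhom M N) (g : modhom N L) (h : modhom M L) :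
  sval h = sval g *m sval f ->
  sval (cut_fmap h) = sval (cut_fmap g) *m sval (cut_fmap f).
Proof.
move=> /= ->; rewrite PhiM !mulmxA -[_ *m cutC _ *m cutR _]mulmxA cutCR.
rewrite -[_ *m unit_op _]mulmxA prerep_hom_unit ?mulmxA ?cutRE //.
exact: Phi_hom (proj2_sig g).
Qed.

Definition cut_functor : mfunctor A B := MFunctor cut_fmap_id cut_fmap_comp.

End CutFunctor.

(** * Direct sums of copies of a space, in coordinates *)

Section Blocks.
Variables (O : finType) (d : nat).

(** The inclusion of the summand [o] into the direct sum over [O] of copies of [K^d]; coordinates
    run through the enumeration of [O * 'I_d]. *)
Definition binj (o : O) : 'M[K]_(#|{: O * 'I_d}|, d) :=
  \matrix_(i, j) (enum_val i == (o, j))%:R.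
Definition bprj (o : O) : 'M[K]_(d, #|{: O * 'I_d}|) := (binj o)^T.

Lemma bprj_binj o o' : bprj o *m binj o' = (o == o')%:R%:M.
Proof.
apply/matrixP=> i j; rewrite !mxE.
rewrite (bigD1 (enum_rank (o, i))) //= !mxE enum_rankK eqxx mul1r.
rewrite big1 ?addr0 => [|k ne_k]; last first.
  rewrite !mxE; case: eqP => [Ek|_]; last by rewrite mul0r.
  by case/eqP: ne_k; rewrite -Ek enum_valK.
by rewrite xpair_eqE; case: (o == o'); case: (i == j).
Qed.

Lemma sum_binj_bprj : \sum_o binj o *m bprj o = 1%:M.
Proof.
apply/matrixP=> i j; rewrite summxE !mxE.
case Ei: (enum_val i) => [oi ii]; case Ej: (enum_val j) => [oj jj].
rewrite (bigD1 oi) //= big1 ?addr0 => [|o ne_o]; last first.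
  rewrite !mxE big1 // => k _; rewrite !mxE Ei xpair_eqE eq_sym (negbTE ne_o).
  by rewrite mul0r.
rewrite !mxE (bigD1 ii) //= big1 ?addr0 => [|k ne_k]; last first.
  by rewrite !mxE Ei xpair_eqE eqxx eq_sym (negbTE ne_k) mul0r.
rewrite !mxE Ei eqxx mul1r Ej -(inj_eq enum_val_inj) Ei Ej.
by congr (_ %:R); rewrite eq_sym.
Qed.

End Blocks.

(** In a category algebra spanned by diagrams every product of two basis elements satisfies
    [prod_is] or [prod_zero]; the latter covers non-composable pairs and composites outside the
    class. *)
Definition prod_is (B : fdalg K) (x y : fd_basis B) (s : K) (z : fd_basis B) :=
  forall t, fd_mul x y t = if t == z then s else 0.

Definition prod_zero (B : fdalg K) (x y : fd_basis B) :=
  forall t, fd_mul x y t = 0.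

Lemma prod_is_sum (B : fdalg K) x y s z D (T : fd_basis B -> 'M[K]_D) :
  prod_is x y s z -> \sum_t fd_mul x y t *: T t = s *: T z.
Proof.
move=> xyz; rewrite (bigD1 z) //= big1 ?addr0 => [|t /negbTE ne_t]; rewrite xyz.
  by rewrite eqxx.
by rewrite ne_t scale0r.
Qed.

Lemma prod_zero_sum (B : fdalg K) x y D (T : fd_basis B -> 'M[K]_D) :
  prod_zero x y -> \sum_t fd_mul x y t *: T t = 0.
Proof. by move=> xy0; rewrite big1 // => t _; rewrite xy0 scale0r. Qed.

Lemma mactM (B : fdalg K) (M : modobj B) x y :
  mact (sval M) x *m mact (sval M) y = \sum_z fd_mul x y z *: mact (sval M) z.
Proof. by case: (proj2_sig M). Qed.

Lemma mact_prod (B : fdalg K) (M : modobj B) x y s z : prod_is x y s z ->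
  mact (sval M) x *m mact (sval M) y = s *: mact (sval M) z.
Proof. by move=> xyz; rewrite mactM (prod_is_sum _ xyz). Qed.

Lemma mact_zero (B : fdalg K) (M : modobj B) x y : prod_zero x y ->
  mact (sval M) x *m mact (sval M) y = 0.
Proof. by move=> xy0; rewrite mactM prod_zero_sum. Qed.

(** * Matrix identities behind the two natural isomorphisms *)

Section FactorIdentities.
Variables d e r m : nat.
Implicit Types (C : 'M[K]_(m, r)) (R : 'M[K]_(r, m)) (E T : 'M[K]_m).

Lemma factor_hom C R E T (S : 'M_(m, d)) (f : 'M_d) :
  C *m R = E -> T *m E = T -> S *m f = T *m S ->
  R *m S *m f = R *m T *m C *m (R *m S).
Proof.
move=> CR TE Sf; rewrite -mulmxA Sf -!mulmxA [C *m _]mulmxA CR.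
by rewrite [T *m (E *m _)]mulmxA TE.
Qed.

Lemma factor_invl C R E (S : 'M_(m, d)) (S' : 'M_(d, m)) :
  C *m R = E -> S *m S' = E -> S' *m S = 1%:M -> S' *m C *m (R *m S) = 1%:M.
Proof.
move=> CR SS' S'S; rewrite -mulmxA [C *m _]mulmxA CR -SS' -mulmxA S'S mulmx1.
exact: S'S.
Qed.

Lemma factor_invr C R E (S : 'M_(m, d)) (S' : 'M_(d, m)) :
  C *m R = E -> R *m C = 1%:M -> S *m S' = E -> R *m S *m (S' *m C) = 1%:M.
Proof.
move=> CR RC SS'; rewrite -mulmxA [S *m _]mulmxA SS' -CR -!mulmxA RC mulmx1.
exact: RC.
Qed.

Lemma factor_nat m' r' d' C R E (S : 'M_(m, d)) (S' : 'M_(d, m)) (R' : 'M_(r', m'))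
    (S1 : 'M_(m', d')) (f : 'M_(d', d)) (F : 'M_(m', m)) :
  C *m R = E -> S *m S' = E -> S' *m S = 1%:M -> S1 *m f = F *m S ->
  R' *m S1 *m f = R' *m F *m C *m (R *m S).
Proof.
move=> CR SS' S'S S1f; rewrite -[RHS]mulmxA [C *m _]mulmxA CR -SS' -[_ *m S' *m S]mulmxA.
by rewrite S'S mulmx1 -!mulmxA S1f.
Qed.

(** The [factor2] identities treat two successive cuts: [C R] first, then [C3 R3] inside it. In the
    application the second idempotent is the projection [j q] onto one summand, seen through the
    first cut. *)
Lemma factor2_hom C R E T (C3 : 'M_(r, e)) (R3 : 'M_(e, r)) (E3 : 'M_r)
    (j : 'M_(m, d)) (f : 'M_d) :
  C *m R = E -> C3 *m R3 = E3 -> R *m T *m C *m E3 = R *m T *m C -> T *m E = T ->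
  T *m j = j *m f ->
  R3 *m R *m j *m f = R3 *m (R *m T *m C) *m C3 *m (R3 *m R *m j).
Proof.
move=> CR CR3 TE3 TE Tj; rewrite -!mulmxA -Tj [C3 *m _]mulmxA CR3.
congr (_ *m _); rewrite !mulmxA TE3 -[_ *m C *m R]mulmxA CR.
by rewrite -[R *m T *m E]mulmxA TE.
Qed.

Lemma factor2_inv C R E (C3 : 'M_(r, e)) (R3 : 'M_(e, r))
    (j : 'M_(m, d)) (q : 'M_(d, m)) :
  C *m R = E -> R3 *m C3 = 1%:M -> C3 *m R3 = R *m (j *m q) *m C ->
  q *m E = q -> q *m j = 1%:M ->
  q *m C *m C3 *m (R3 *m R *m j) = 1%:M /\ R3 *m R *m j *m (q *m C *m C3) = 1%:M.
Proof.
move=> CR RC3 CR3 qE qj; split.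
  rewrite -!mulmxA [C3 *m _]mulmxA CR3 -!mulmxA ![C *m (R *m _)]mulmxA CR.
  by rewrite ![q *m (E *m _)]mulmxA qE [q *m (j *m _)]mulmxA qj mul1mx.
transitivity (R3 *m (R *m (j *m q) *m C) *m C3); first by rewrite !mulmxA.
by rewrite -CR3 !mulmxA RC3 mul1mx.
Qed.

Lemma factor2_nat m' r' e' d' C R E (C3 : 'M_(r, e)) (R3 : 'M_(e, r))
    (j : 'M_(m, d)) (q : 'M_(d, m)) (R3' : 'M_(e', r')) (R' : 'M_(r', m'))
    (E' : 'M_m') (F : 'M_(m', m)) (j' : 'M_(m', d')) (f : 'M_(d', d)) :
  C *m R = E -> C3 *m R3 = R *m (j *m q) *m C -> q *m E = q -> q *m j = 1%:M ->
  F *m E = E' *m F -> R' *m E' = R' -> F *m j = j' *m f ->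
  R3' *m R' *m j' *m f = R3' *m (R' *m F *m C) *m C3 *m (R3 *m R *m j).
Proof.
move=> CR CR3 qE qj FE RE Fj.
rewrite -!mulmxA [C3 *m _]mulmxA CR3 -!mulmxA ![C *m (R *m _)]mulmxA CR.
rewrite ![q *m (E *m _)]mulmxA qE qj mulmx1 [F *m (E *m _)]mulmxA FE -!mulmxA.
by rewrite [R' *m (E' *m _)]mulmxA RE Fj.
Qed.

End FactorIdentities.

(* [B] is the category algebra of a category with objects [O] and [A] the
   endomorphism algebra of [o0]; [u], [v] exhibit every object as a retract of
   [o0] up to the scalar [w], and [ext f] is the conjugate [u f v]. *)
Section RetractMorita.
Variables (A B : fdalg K) (O : finType) (o0 : O).
Variables (src tgt : fd_basis B -> O) (idx u v : O -> fd_basis B).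
Variables (iota : fd_basis A -> fd_basis B) (ext : fd_basis B -> fd_basis A).
Variables (hext : fd_basis B -> fd_basis B) (w : O -> K) (i0 : fd_basis A).

Hypothesis w_neq0 : forall o, w o != 0.
Hypothesis w_o0 : w o0 = 1.
Hypothesis one_A : forall x, @fd_one K A x = if x == i0 then 1 else 0.
Hypothesis one_B : forall z, @fd_one K B z = if z == idx (src z) then 1 else 0.
Hypothesis src_idx : forall o, src (idx o) = o.
Hypothesis tgt_idx : forall o, tgt (idx o) = o.
Hypothesis src_u : forall o, src (u o) = o.
Hypothesis tgt_u : forall o, tgt (u o) = o0.
Hypothesis tgt_v : forall o, tgt (v o) = o.
Hypothesis src_iota : forall x, src (iota x) = o0.
Hypothesis tgt_iota : forall x, tgt (iota x) = o0.
Hypothesis iota_i0 : iota i0 = idx o0.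
Hypothesis ext_iota : forall x, ext (iota x) = x.
Hypothesis prod_disc : forall g f, src g != tgt f -> prod_zero g f.
Hypothesis prod_1l : forall f, prod_is (idx (tgt f)) f 1 f.
Hypothesis prod_1r : forall f, prod_is f (idx (src f)) 1 f.
Hypothesis prod_iota : forall x y,
  (exists s z, prod_is x y s z /\ prod_is (iota x) (iota y) s (iota z))
  \/ (prod_zero x y /\ prod_zero (iota x) (iota y)).
(** The rule [(u g v)(u f v) = w (u g f v)], where the inner [v u] is the scalar of the middle
    object. *)
Hypothesis prod_ext : forall g f, src g = tgt f ->
  (exists s z, [/\ prod_is g f s z, prod_is (ext g) (ext f) (s * w (tgt f)) (ext z),
                   src z = src f & tgt z = tgt g])
  \/ (prod_zero g f /\ prod_zero (ext g) (ext f)).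
(** [hext f] names the intermediate product [f v], so that [u (f v)] is reached by two products of
    basis elements. *)
Hypothesis prod_hext : forall f, prod_is f (v (src f)) 1 (hext f).
Hypothesis prod_uhext : forall f, prod_is (u (tgt f)) (hext f) 1 (iota (ext f)).
Hypothesis prod_vu : forall o, prod_is (v o) (u o) (w o) (idx o).

Lemma one_A_sum D (T : fd_basis A -> 'M[K]_D) : unit_op T = T i0.
Proof.
rewrite /unit_op (bigD1 i0) //= big1 => [|x /negbTE ne_x].
  by rewrite one_A eqxx scale1r addr0.
by rewrite one_A ne_x scale0r.
Qed.

Lemma one_B_sum D (T : fd_basis B -> 'M[K]_D) : unit_op T = \sum_o T (idx o).
Proof.
rewrite /unit_op (partition_big src xpredT) //=; apply: eq_bigr => o _.
rewrite (bigD1 (idx o)) ?src_idx //= big1 => [|z /andP[/eqP <- /negbTE ne_z]].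
  by rewrite one_B src_idx eqxx scale1r addr0.
by rewrite one_B ne_z scale0r.
Qed.

Lemma mact_one_A (M : modobj A) : mact (sval M) i0 = 1%:M.
Proof. by rewrite -one_A_sum; case: (proj2_sig M). Qed.

Lemma mact_one_B (M : modobj B) : \sum_o mact (sval M) (idx o) = 1%:M.
Proof. by rewrite -one_B_sum; case: (proj2_sig M). Qed.

Section Restrict.
Variable M : modobj B.
Definition res_act (x : fd_basis A) := mact (sval M) (iota x).

Lemma res_actM x y : res_act x *m res_act y = \sum_z fd_mul x y z *: res_act z.
Proof.
rewrite /res_act; case: (prod_iota x y) => [[s [z [xyz ixyz]]]|[xy0 ixy0]].
  by rewrite (mact_prod _ ixyz) (prod_is_sum _ xyz).
by rewrite (mact_zero _ ixy0) (prod_zero_sum _ xy0).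
Qed.

Lemma res_act1l x : unit_op res_act *m res_act x = res_act x.
Proof.
rewrite one_A_sum /res_act iota_i0 -(tgt_iota x).
by rewrite (mact_prod _ (prod_1l _)) scale1r.
Qed.

Lemma res_act1r x : res_act x *m unit_op res_act = res_act x.
Proof.
rewrite one_A_sum /res_act iota_i0 -(src_iota x).
by rewrite (mact_prod _ (prod_1r _)) scale1r.
Qed.

Definition res_prerep := Prerep res_actM res_act1l res_act1r.
End Restrict.

Section Induce.
Variable M : modobj A.
Let d := md (sval M).
(** In a product [g f] the factor [w (src g)^-1] cancels the [w (tgt f)] coming from [prod_ext], and
    [w (src f)^-1] remains. *)
Definition ind_act (f : fd_basis B) : 'M[K]_(#|{: O * 'I_d}|) :=
  binj d (tgt f) *m ((w (src f))^-1 *: mact (sval M) (ext f)) *m bprj d (src f).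

Lemma ind_actM g f : ind_act g *m ind_act f = \sum_z fd_mul g f z *: ind_act z.
Proof.
rewrite /ind_act !mulmxA -[_ *m bprj _ _ *m binj _ _]mulmxA bprj_binj.
have [Egf|ne_gf] := eqVneq (src g) (tgt f); last first.
  by rewrite raddf0 mulmx0 !mul0mx (prod_zero_sum _ (prod_disc ne_gf)).
have scaleM2 a b (X Y : 'M[K]_d) : (a *: X) *m (b *: Y) = (a * b) *: (X *m Y).
  by rewrite -scalemxAl -scalemxAr scalerA.
rewrite mulmx1 -[binj _ _ *m _ *m (_ *: _)]mulmxA scaleM2.
case: (prod_ext Egf) => [[s [z [gfz egfz sz tz]]]|[gf0 egf0]]; last first.
  by rewrite (mact_zero _ egf0) (prod_zero_sum _ gf0) scaler0 mulmx0 mul0mx.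
rewrite (mact_prod _ egfz) (prod_is_sum _ gfz) scalerA sz tz Egf.
rewrite scalemxAl scalemxAr scalerA; congr (_ *m (_ *: _) *m _).
by rewrite [s * w _]mulrC mulrACA mulVf // mul1r mulrC.
Qed.

Lemma ind_act1l f : unit_op ind_act *m ind_act f = ind_act f.
Proof.
rewrite one_B_sum mulmx_suml (bigD1 (tgt f)) //= big1 => [|o ne_o].
  by rewrite ind_actM (prod_is_sum _ (prod_1l f)) scale1r addr0.
by rewrite ind_actM prod_zero_sum //; apply: prod_disc; rewrite src_idx.
Qed.

Lemma ind_act1r f : ind_act f *m unit_op ind_act = ind_act f.
Proof.
rewrite one_B_sum mulmx_sumr (bigD1 (src f)) //= big1 => [|o ne_o].
  by rewrite ind_actM (prod_is_sum _ (prod_1r f)) scale1r addr0.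
by rewrite ind_actM prod_zero_sum //; apply: prod_disc; rewrite tgt_idx eq_sym.
Qed.

Definition ind_prerep := Prerep ind_actM ind_act1l ind_act1r.
End Induce.

Definition res_functor : mfunctor B A.
Proof.
by apply: (@cut_functor B A res_prerep (fun M N f => f)) => //= M N f hf x; apply: hf.
Defined.

Definition block_map d1 d2 (f : 'M[K]_(d2, d1)) :
    'M[K]_(#|{: O * 'I_d2}|, #|{: O * 'I_d1}|) :=
  \sum_o binj d2 o *m f *m bprj d1 o.

Lemma block_map_binj d1 d2 (f : 'M[K]_(d2, d1)) o :
  block_map f *m binj d1 o = binj d2 o *m f.
Proof.
rewrite /block_map mulmx_suml (bigD1 o) //= big1 => [|o' /negbTE ne_o].
  by rewrite -mulmxA bprj_binj eqxx mulmx1 addr0.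
by rewrite -mulmxA bprj_binj ne_o raddf0 mulmx0.
Qed.

Lemma bprj_block_map d1 d2 (f : 'M[K]_(d2, d1)) o :
  bprj d2 o *m block_map f = f *m bprj d1 o.
Proof.
rewrite /block_map mulmx_sumr (bigD1 o) //= big1 => [|o' ne_o].
  by rewrite !mulmxA bprj_binj eqxx mul1mx addr0.
by rewrite !mulmxA bprj_binj eq_sym (negbTE ne_o) raddf0 !mul0mx.
Qed.

Lemma block_map1 d : block_map (1%:M : 'M[K]_d) = 1%:M.
Proof.
by rewrite -(sum_binj_bprj O d); apply: eq_bigr => o _; rewrite mulmx1.
Qed.

Lemma block_mapM d1 d2 d3 (f : 'M[K]_(d2, d1)) (g : 'M[K]_(d3, d2)) :
  block_map (g *m f) = block_map g *m block_map f.
Proof.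
rewrite {3}/block_map mulmx_sumr; apply: eq_bigr => o _.
by rewrite !mulmxA block_map_binj.
Qed.

Lemma block_map_hom (M N : modobj A) (f : 'M[K]_(md (sval N), md (sval M))) :
  is_hom f -> forall x, block_map f *m ind_act M x = ind_act N x *m block_map f.
Proof.
move=> hf x; rewrite /ind_act !mulmxA block_map_binj -[RHS]mulmxA bprj_block_map.
by rewrite !mulmxA -[_ *m f *m _]mulmxA -scalemxAr hf scalemxAl !mulmxA.
Qed.

Definition ind_functor : mfunctor A B.
Proof.
apply: (@cut_functor A B ind_prerep (fun M N f => block_map f)) => /=.
- by move=> M; apply: block_map1.
- by move=> M N L f g; apply: block_mapM.
- exact: block_map_hom.
Defined.

Section IndRes.
Variable M : modobj B.
Let W : modobj A := cut (res_prerep M).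
Let C := cutC (res_prerep M).
Let R := cutR (res_prerep M).
Let act := mact (sval M).

(** With [W = id_n M], this is the map from [M] to the sum of copies of [W] with components [u_o];
    [gather] goes back by [w_o^-1 v_o]. The factors [R] and [C] only pass between [M] and the
    coordinates of [W]. *)
Definition spread : 'M[K]_(#|{: O * 'I_(md (sval W))}|, md (sval M)) :=
  \sum_o binj _ o *m (R *m act (u o)).
Definition gather : 'M[K]_(md (sval M), #|{: O * 'I_(md (sval W))}|) :=
  \sum_o (w o)^-1 *: (act (v o) *m C) *m bprj _ o.

Lemma res_idem : C *m R = act (idx o0).
Proof. by rewrite cutCR one_A_sum /= /res_act iota_i0. Qed.

Lemma res_idem_u o : C *m R *m act (u o) = act (u o).
Proof. by rewrite res_idem -(tgt_u o) (mact_prod _ (prod_1l _)) scale1r. Qed.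

Lemma act_ext f : act (u (tgt f)) *m act f *m act (v (src f)) = act (iota (ext f)).
Proof.
rewrite -mulmxA (mact_prod _ (prod_hext f)) scale1r.
by rewrite (mact_prod _ (prod_uhext f)) scale1r.
Qed.

Lemma act_ext_u f :
  act (iota (ext f)) *m act (u (src f)) = w (src f) *: (act (u (tgt f)) *m act f).
Proof.
rewrite -act_ext -mulmxA (mact_prod _ (prod_vu _)) -scalemxAr -mulmxA.
by rewrite (mact_prod _ (prod_1r f)) scale1r.
Qed.

(** Only equal objects contribute; each gives [w^-1 v u = id_o], and the identities sum to 1. *)
Lemma gather_spread : gather *m spread = 1%:M.
Proof.
rewrite -(mact_one_B M) mulmx_suml; apply: eq_bigr => o _.
rewrite /spread mulmx_sumr (bigD1 o) //= big1 => [|o' ne_o]; last first.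
  by rewrite mulmxA -[_ *m bprj _ _ *m _]mulmxA bprj_binj eq_sym (negbTE ne_o)
     raddf0 mulmx0 mul0mx.
rewrite addr0 !mulmxA -[_ *m bprj _ _ *m _]mulmxA bprj_binj eqxx mulmx1.
rewrite -!scalemxAl -!mulmxA [C *m _]mulmxA res_idem_u.
by rewrite (mact_prod _ (prod_vu o)) scalerA mulVf // scale1r.
Qed.

Lemma spread_act f : spread *m act f = ind_act W f *m spread.
Proof.
rewrite /spread mulmx_suml (bigD1 (tgt f)) //= big1 => [|o ne_o]; last first.
  rewrite -!mulmxA (@mact_zero B M) ?mulmx0 //.
  by apply: prod_disc; rewrite src_u.
rewrite addr0 mulmx_sumr (bigD1 (src f)) //= big1 => [|o ne_o]; last first.
  by rewrite /ind_act mulmxA -[_ *m bprj _ _ *m _]mulmxA bprj_binj eq_sym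
     (negbTE ne_o) raddf0 mulmx0 mul0mx.
rewrite addr0 /ind_act !mulmxA -[_ *m bprj _ _ *m _]mulmxA bprj_binj eqxx mulmx1.
rewrite /= -/R -/C -!mulmxA; congr (_ *m _).
rewrite -!scalemxAl -!mulmxA [C *m _]mulmxA res_idem_u /res_act -/act.
by rewrite act_ext_u -scalemxAr scalerA mulVf // scale1r.
Qed.

(** This composite is the idempotent whose image is the induced module: on the summand [o] it is
    [w^-1 u v], the action of [id_o]. *)
Lemma spread_gather : spread *m gather = unit_op (ind_act W).
Proof.
rewrite one_B_sum mulmx_suml; apply: eq_bigr => o _.
rewrite /gather mulmx_sumr (bigD1 o) //= big1 => [|o' ne_o]; last first.
  rewrite -!scalemxAl -scalemxAr !mulmxA -[_ *m act (u o) *m _]mulmxA.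
  rewrite (@mact_zero B M) ?mulmx0 ?mul0mx ?scaler0 //.
  by apply: prod_disc; rewrite src_u tgt_v eq_sym.
rewrite addr0 /ind_act src_idx tgt_idx !mulmxA; congr (_ *m _).
rewrite -!scalemxAr !mulmxA; congr (_ *: _).
rewrite /= -/R -/C -!mulmxA; congr (_ *m (_ *m _)); rewrite mulmxA; congr (_ *m _).
(* [u v] is read as [u id_o v], the case [f = idx o] of [act_ext]. *)
rewrite /res_act -/act -act_ext src_idx tgt_idx -mulmxA.
have -> : act (idx o) *m act (v o) = act (v o) => //.
by rewrite -{1}(tgt_v o) (mact_prod _ (prod_1l _)) scale1r.
Qed.
End IndRes.

Lemma spread_nat (M N : modobj B) (f : modhom M N) : spread N *m sval f =
  @block_map (md (sval (cut (res_prerep M)))) (md (sval (cut (res_prerep N))))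
    (cutR (res_prerep N) *m sval f *m cutC (res_prerep M)) *m spread M.
Proof.
rewrite /spread mulmx_suml mulmx_sumr; apply: eq_bigr => o _.
rewrite [RHS]mulmxA block_map_binj -!mulmxA; congr (_ *m (_ *m _)).
by rewrite -(proj2_sig f) -[in LHS](res_idem_u M o) -mulmxA.
Qed.

Lemma ind_res_iso : nat_iso_id res_functor ind_functor.
Proof.
pose G M := ind_prerep (cut (res_prerep M)).
exists (fun M => cutR (G M) *m spread M); split.
- move=> M f; apply: factor_hom (cutCR (G M)) _ (spread_act M f).
  exact: ind_act1r.
- move=> M; exists (gather M *m cutC (G M)).
  have SS := spread_gather M; have S1 := gather_spread M; split.
    exact: factor_invl (cutCR (G M)) SS S1.
  exact: factor_invr (cutCR (G M)) (cutRC (G M)) SS.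
- move=> M N f.
  exact: factor_nat (cutCR (G M)) (spread_gather M) (gather_spread M) (spread_nat f).
Qed.

Lemma ind_act_iota (M : modobj A) x :
  ind_act M (iota x) = binj _ o0 *m mact (sval M) x *m bprj _ o0.
Proof. by rewrite /ind_act src_iota tgt_iota ext_iota w_o0 invr1 scale1r. Qed.

(** Since [w o0 = 1] and [ext] undoes [iota], the identity [iota i0] acts on the induced
    representation as the projection [j q] onto the summand of [o0], which is a copy of [M]. *)
Lemma res_ind_iso : nat_iso_id ind_functor res_functor.
Proof.
pose F M := res_prerep (cut (ind_prerep M)).
pose j (M : modobj A) : 'M[K]_(_, md (sval M)) := binj (md (sval M)) o0.
pose q (M : modobj A) : 'M[K]_(md (sval M), _) := bprj (md (sval M)) o0.
have E3 M : cutC (F M) *m cutR (F M)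
    = cutR (ind_prerep M) *m (j M *m q M) *m cutC (ind_prerep M).
  by rewrite cutCR one_A_sum /= /res_act /= ind_act_iota mact_one_A mulmx1.
have qj M : q M *m j M = 1%:M by rewrite bprj_binj eqxx.
have jq M : j M *m q M = ind_act M (iota i0).
  by rewrite ind_act_iota mact_one_A mulmx1.
(* [j q] is an action, so it absorbs the unit on its right; [q j = 1] then removes [j]. *)
have qE M : q M *m unit_op (ind_act M) = q M.
  have := congr1 (mulmx (q M)) (ind_act1r M (iota i0)).
  by rewrite -jq !mulmxA qj !mul1mx.
exists (fun M => cutR (F M) *m cutR (ind_prerep M) *m j M); split.
- move=> M x.
  apply: (factor2_hom (cutCR (ind_prerep M)) (cutCR (F M))) => /=.
  + exact: (pact1r (F M)).
  + exact: ind_act1r.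
  + by rewrite ind_act_iota -mulmxA -/(q M) -/(j M) qj mulmx1.
- move=> M; exists (q M *m cutC (ind_prerep M) *m cutC (F M)).
  exact: factor2_inv (cutCR (ind_prerep M)) (cutRC (F M)) (E3 M) (qE M) (qj M).
- move=> M N f.
  have hf := block_map_hom (proj2_sig f).
  have fE := @prerep_hom_unit B (ind_prerep M) (ind_prerep N) _ hf.
  exact: factor2_nat (cutCR (ind_prerep M)) (E3 M) (qE M) (qj M) fE
    (cutRE (ind_prerep N)) (block_map_binj _ _).
Qed.

Theorem retract_morita : morita_equiv A B.
Proof.
by exists ind_functor, res_functor; split; [apply: res_ind_iso | apply: ind_res_iso].
Qed.

End RetractMorita.
End CutMorita.

(** * Gluing partitions *)

Section PartitionBlocks.
Variable N : nat.
Implicit Types P Q : {set {set 'I_N}}.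

Definition points (M : nat) : {set 'I_N} := [set x : 'I_N | x < M].

Lemma blkP P x y :
  reflect (exists u v : 'I_N, [/\ val u = x, val v = y &
             exists2 B, B \in P & (u \in B) && (v \in B)]) (blk P x y).
Proof.
apply: (iffP existsP) => [[B /andP[PB /existsP[u /andP[Bu /existsP[v]]]]]|].
  case/andP=> Bv /andP[/eqP ux /eqP vy]; exists u, v; split=> //.
  by exists B => //; rewrite Bu Bv.
case=> u [v [ux vy [B PB /andP[Bu Bv]]]]; exists B; rewrite PB /=.
apply/existsP; exists u; rewrite Bu /=; apply/existsP; exists v.
by rewrite Bv ux vy !eqxx.
Qed.

Lemma blk_val P (u v : 'I_N) :
  reflect (exists2 B, B \in P & (u \in B) && (v \in B)) (blk P u v).
Proof.
apply: (iffP (blkP _ _ _)) => [[u' [v' [/val_inj-> /val_inj-> //]]]|ex].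
by exists u, v.
Qed.

Lemma blk_sym P x y : blk P x y = blk P y x.
Proof.
by apply/blkP/blkP => -[u [v [ux vy [B PB Buv]]]]; exists v, u; split=> //;
  exists B => //; rewrite andbC.
Qed.

Lemma blk_pblock P M : partition P (points M) ->
  forall u v : 'I_N, blk P u v = (v \in pblock P u).
Proof.
move=> partP u v; have tiP := partition_trivIset partP.
apply/blk_val/idP => [[B PB /andP[Bu Bv]]|].
  by rewrite (def_pblock tiP PB Bu).
have [Pu|] := boolP (u \in cover P).
  by exists (pblock P u); rewrite ?pblock_mem // mem_pblock Pu.
(* Outside the cover [pblock] is the default empty set. *)
by rewrite -mem_pblock /pblock; case: pickP => [B /andP[_ /= ->] //|_]; rewrite !inE.
Qed.

Lemma blk_lt P M x y : partition P (points M) -> blk P x y -> x < M /\ y < M.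
Proof.
move=> partP /blkP[u [v [<- <- [B PB /andP[Bu Bv]]]]].
have /and3P[/eqP covP _ _] := partP.
have inM w : w \in B -> w < M.
  move=> Bw; have: w \in points M by rewrite -covP; apply/bigcupP; exists B.
  by rewrite inE.
by split; apply: inM.
Qed.

Lemma blk_refl P M x : partition P (points M) -> M <= N -> x < M -> blk P x x.
Proof.
move=> partP leMN ltxM; have ltxN := leq_trans ltxM leMN.
rewrite -[x]/(val (Ordinal ltxN)) (blk_pblock partP) mem_pblock (cover_partition partP).
by rewrite inE.
Qed.

Lemma blk_trans P M x y z : partition P (points M) ->
  blk P x y -> blk P y z -> blk P x z.
Proof.
move=> partP /blkP[u [v [<- <- [B PB /andP[Bu Bv]]]]].
case/blkP=> v' [w [/val_inj-> <- [B' PB' /andP[Bv' Bw]]]].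
apply/blk_val; exists B => //; rewrite Bu.
by rewrite -(def_pblock (partition_trivIset partP) PB Bv)
  (def_pblock (partition_trivIset partP) PB' Bv').
Qed.

Lemma blk_inj P Q M : partition P (points M) -> partition Q (points M) ->
  (forall x y, x < M -> y < M -> blk P x y = blk Q x y) -> P = Q.
Proof.
move=> partP partQ eqPQ.
rewrite -(equivalence_partition_pblock partP) -(equivalence_partition_pblock partQ).
apply: eq_in_imset => u; rewrite inE => ltu; apply/setP=> v; rewrite !inE.
by case ltv: (v < M) => //=; rewrite -(blk_pblock partP) -(blk_pblock partQ) eqPQ.
Qed.

Section ClassPartition.
Variables (T : eqType) (M : nat) (c : nat -> T).

(** Partitions are handled as fibres of colourings of the points: a colouring matters only through
    its equality pattern ([eq_class_part]), and [cls P] is the canonical colouring of a given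
    [P]. *)
Definition class_part : {set {set 'I_N}} :=
  equivalence_partition (fun u v : 'I_N => c u == c v) (points M).

Lemma class_partP : partition class_part (points M).
Proof.
apply: equivalence_partitionP => u v w _ _ _.
by split; [exact: eqxx | move/eqP->].
Qed.

Lemma blk_class_part x y : M <= N ->
  blk class_part x y = [&& x < M, y < M & c x == c y].
Proof.
move=> leMN; apply/idP/and3P => [bxy|[ltx lty cxy]].
  have [ltx lty] := blk_lt class_partP bxy; split=> //.
  case/blkP: bxy => u [v [<- <- [B]]].
  by case/imsetP=> w _ ->; rewrite !inE => /andP[/andP[_ /eqP <-] /andP[_ /eqP <-]].
have [ltxN ltyN] := (leq_trans ltx leMN, leq_trans lty leMN).
rewrite -[x]/(val (Ordinal ltxN)) -[y]/(val (Ordinal ltyN)) (blk_pblock class_partP).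
rewrite pblock_equivalence_partition ?inE //= => u v w _ _ _.
by split; [exact: eqxx | move/eqP->].
Qed.

End ClassPartition.

Lemma eq_class_part (T1 T2 : eqType) M (c1 : nat -> T1) (c2 : nat -> T2) : M <= N ->
  (forall x y, x < M -> y < M -> (c1 x == c1 y) = (c2 x == c2 y)) ->
  class_part M c1 = class_part M c2.
Proof.
move=> leMN eqc; apply: (@blk_inj _ _ M); rewrite ?class_partP // => x y ltx lty.
by rewrite !blk_class_part // eqc.
Qed.

Definition cls P (x : nat) : {set 'I_N} := [set v : 'I_N | blk P x v].

Lemma cls_eq P M x y : partition P (points M) -> M <= N -> x < M -> y < M ->
  (cls P x == cls P y) = blk P x y.
Proof.
move=> partP leMN ltx lty; apply/eqP/idP => [eq_xy|bxy].
  have ltyN := leq_trans lty leMN.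
  have: Ordinal ltyN \in cls P y by rewrite inE (blk_refl partP).
  by rewrite -eq_xy inE.
apply/setP=> v; rewrite !inE; apply/idP/idP; apply: (blk_trans partP) => //.
by rewrite blk_sym.
Qed.

Lemma class_part_cls P M : partition P (points M) -> M <= N -> class_part M (cls P) = P.
Proof.
move=> partP leMN; apply: (@blk_inj _ _ M); rewrite ?class_partP // => x y ltx lty.
by rewrite blk_class_part // ltx lty (cls_eq partP).
Qed.

End PartitionBlocks.

(** The number of colours depends only on which elements share one, so loops can be counted with any
    colouring of the components. *)
Lemma size_undup_map (S T1 T2 : eqType) (f : S -> T1) (g : S -> T2) (s : seq S) :
  {in s &, forall x y, (f x == f y) = (g x == g y)} ->
  size (undup (map f s)) = size (undup (map g s)).
Proof.
elim: s => //= x s IHs eq_fg.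
have eq_fgx y : y \in s -> (f x == f y) = (g x == g y).
  by move=> sy; rewrite eq_fg // !inE ?eqxx ?sy ?orbT.
have eq_mem : (f x \in map f s) = (g x \in map g s).
  by apply/mapP/mapP => -[y sy /eqP eqxy]; exists y => //; apply/eqP; move: eqxy;
    rewrite eq_fgx.
rewrite eq_mem; case: ifP => _ /=; rewrite IHs // => y z sy sz;
  by rewrite eq_fg // inE ?sy ?sz orbT.
Qed.

(** * Connected components of two glued diagrams *)

Section Glue.
Variables (N i j k : nat).
Variables P Q : {set {set 'I_N}}.
Local Notation V := (i + j + k).
Local Notation gc := (glue_conn i j k P Q).

Lemma glue_rel_sym : symmetric (@glue_rel N i j k P Q).
Proof.
move=> x y; rewrite /glue_rel ![blk _ y _]blk_sym ![blk _ (y - i) _]blk_sym.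
by congr orb; rewrite andbCA.
Qed.

Lemma glue_connP x y :
  reflect (exists a b : 'I_V, [/\ val a = x, val b = y & connect (@glue_rel N i j k P Q) a b])
    (gc x y).
Proof.
apply: (iffP existsP) => [[a /existsP[b /and3P[/eqP ax /eqP b_y cab]]]|].
  by exists a, b.
case=> a [b [ax b_y cab]]; exists a; apply/existsP; exists b.
by rewrite ax b_y !eqxx.
Qed.

Lemma glue_conn_val (a b : 'I_V) : gc a b = connect (@glue_rel N i j k P Q) a b.
Proof.
apply/glue_connP/idP => [[a' [b' [/val_inj-> /val_inj-> //]]]|cab].
by exists a, b.
Qed.

Lemma glue_conn_lt x y : gc x y -> x < V /\ y < V.
Proof. by case/glue_connP=> a [b [<- <- _]]; split; apply: ltn_ord. Qed.

Lemma glue_conn_refl x : x < V -> gc x x.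
Proof. by move=> ltx; rewrite -[x]/(val (Ordinal ltx)) glue_conn_val. Qed.

Lemma glue_conn_sym x y : gc x y = gc y x.
Proof.
by apply/glue_connP/glue_connP => -[a [b [<- <- cab]]]; exists b, a; split=> //;
  rewrite (sym_connect_sym glue_rel_sym).
Qed.

Lemma glue_conn_trans x y z : gc x y -> gc y z -> gc x z.
Proof.
case/glue_connP=> a [b [<- <- cab]] /glue_connP[b' [c [/val_inj-> <- cbc]]].
by rewrite glue_conn_val (connect_trans cab).
Qed.

Lemma glue_connL x y : x < i + j -> y < i + j -> blk P x y -> gc x y.
Proof.
move=> ltx lty bxy.
have [ltxV ltyV] := (ltn_addr k ltx, ltn_addr k lty).
rewrite -[x]/(val (Ordinal ltxV)) -[y]/(val (Ordinal ltyV)) glue_conn_val.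
by apply: connect1; rewrite /glue_rel /= ltx lty bxy.
Qed.

Lemma glue_connR x y : x < j + k -> y < j + k -> blk Q x y -> gc (i + x) (i + y).
Proof.
rewrite -(ltn_add2l i) addnA => ltx; rewrite -(ltn_add2l i) addnA => lty bxy.
rewrite -[i + x]/(val (Ordinal ltx)) -[i + y]/(val (Ordinal lty)) glue_conn_val.
by apply: connect1; rewrite /glue_rel /= !leq_addr !addKn bxy orbT.
Qed.

(** Connection is the least equivalence containing the blocks of both diagrams: a colouring constant
    on blocks is constant along paths. *)
Lemma glue_conn_min (T : Type) (c : nat -> T) :
  (forall x y, x < i + j -> y < i + j -> blk P x y -> c x = c y) ->
  (forall x y, x < j + k -> y < j + k -> blk Q x y -> c (i + x) = c (i + y)) ->
  forall x y, gc x y -> c x = c y.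
Proof.
move=> cP cQ x y /glue_connP[a [b [<- <- /connectP[p]]]].
elim: p a => [|a' p IHp] a /= => [_ -> //|/andP[aa' pathp] eqb].
rewrite -(IHp a') // => {pathp eqb IHp}.
case/orP: aa' => [/and3P[lta lta' baa']|/and3P[lea lea' baa']]; first exact: cP.
by have := cQ _ _ _ _ baa'; rewrite !subnKC // !ltn_subLR // addnA; apply.
Qed.

Definition gcls (x : nat) : {set 'I_V} := [set v : 'I_V | gc x v].

(** Both the composite and the number of loops can be read off from any such colouring, so the
    components of a gluing have to be determined only once. *)
Definition classifies (T : eqType) (c : nat -> T) :=
  forall x y, x < V -> y < V -> gc x y = (c x == c y).

Lemma gcls_classifies : classifies gcls.
Proof.
move=> x y ltx lty; apply/idP/eqP => [cxy|eqxy].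
  apply/setP=> v; rewrite !inE; apply/idP/idP; last exact: glue_conn_trans.
  by apply: glue_conn_trans; rewrite glue_conn_sym.
have: Ordinal lty \in gcls y by rewrite inE glue_conn_refl.
by rewrite -eqxy inE.
Qed.

Variables (T : eqType) (c : nat -> T).
Hypothesis cc : classifies c.

Lemma dcomp_class_part : i + k <= N ->
  dcomp i j k P Q = class_part N (i + k) (fun x => c (emb i j x)).
Proof.
move=> leN; apply: eq_in_imset => u; rewrite inE => ltu; apply/setP=> v; rewrite !inE.
have emb_lt x : x < i + k -> emb i j x < V.
  by rewrite /emb; case: ifP; lia.
by case ltv: (v < i + k) => //=; rewrite cc ?emb_lt.
Qed.

(** One entry for each middle point whose component stays in the middle; the loops are the distinct
    entries. *)
Definition mid_classes : seq T :=
  [seq c x | x <- iota i j & all (fun y => c y != c x) (iota 0 i ++ iota (i + j) k)].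

Lemma dloops_mid_classes : dloops i j k P Q = size (undup mid_classes).
Proof.
pose e := connect (@glue_rel N i j k P Q).
pose A := [set x : 'I_V | (i <= x < i + j) &&
  all (fun y => c y != c x) (iota 0 i ++ iota (i + j) k)].
pose f (x : 'I_V) := [set y : 'I_V | e x y].
have eqe (x y : 'I_V) : e x y = (c x == c y) by rewrite -cc // glue_conn_val.
have out y : (y \in iota 0 i ++ iota (i + j) k) = (y < V) && ~~ (i <= y < i + j).
  by rewrite mem_cat !mem_iota; lia.
transitivity #|f @: A|.
  apply: eq_card => B; rewrite !inE; apply/andP/imsetP => [[/imsetP[x _ defB] Bmid]|].
    have fx : B = f x by rewrite defB; apply/setP=> y; rewrite !inE.
    exists x => //; rewrite inE; move/forallP: Bmid => Bmid.
    have midx y : c x = c y -> y < V -> i <= y < i + j.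
      move=> cxy ltyV; apply: (implyP (Bmid (Ordinal ltyV))).
      by rewrite fx inE eqe cxy eqxx.
    rewrite midx //=; apply/allP=> y; rewrite out => /andP[ltyV].
    by apply: contra => /eqP cyx; apply: midx.
  case=> x; rewrite inE => /andP[xmid /allP xout] ->; split.
    by apply/imsetP; exists x => //; apply/setP=> y; rewrite !inE.
  apply/forallP=> y; apply/implyP; rewrite inE eqe => /eqP cxy.
  apply: contraT => ymid; have := xout y; rewrite out ymid ltn_ord -cxy eqxx /=.
  by move/(_ isT).
transitivity (size (undup [seq f x | x <- enum A])).
  rewrite -(card_uniqP (undup_uniq _)); apply: eq_card => B; rewrite mem_undup.
  by apply/imsetP/mapP => -[x Ax ->]; exists x; rewrite ?mem_enum // -mem_enum.
rewrite (@size_undup_map _ _ _ f (fun x => c (val x))) => [|x y _ _]; last first.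
  rewrite /= -eqe; apply/eqP/idP => [eqf|exy].
    by have: y \in f y; [rewrite inE eqe eqxx | rewrite -eqf inE].
  by apply/setP=> z; rewrite !inE !eqe; move: exy; rewrite eqe => /eqP->.
apply/perm_size/uniq_perm; rewrite ?undup_uniq // => t; rewrite !mem_undup.
apply/mapP/mapP => -[x]; rewrite ?mem_enum ?mem_filter ?inE => /andP[].
  move=> midx outx ->; exists (val x) => //.
  by rewrite mem_filter mem_iota midx outx.
move=> outx; rewrite mem_iota => midx ->.
have ltxV : x < V by lia.
by exists (Ordinal ltxV) => //; rewrite mem_enum inE /= midx outx.
Qed.

End Glue.

(** * Diagrams drawn on longer rows *)

Lemma ltn_nge_addr n x : (n + x < n) = false.
Proof. by rewrite ltnNge leq_addr. Qed.

Definition liftc (T L : Type) (c : nat -> T) (s : nat + L) : T + L :=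
  match s with inl x => inl (c x) | inr l => inr l end.

(* The label [l] of a row is 0, 1 or 2: lower, middle (glued) or upper. *)
Definition tag_row (off l : nat) (s : nat + nat) : nat + (nat * nat) :=
  match s with inl x => inl (off + x) | inr t => inr (l, t) end.

(* A way to place [m] strands on a row of [n] points: [d y = inl x] if [y] is
   the [x]-th strand, [phi x = y], and [d y = inr t] if [y] lies in the extra
   block with label [t]. *)
Definition row (m n : nat) (d : nat -> nat + nat) (phi : nat -> nat) : Prop :=
  (forall x, x < m -> phi x < n /\ d (phi x) = inl x) /\
  (forall y x, y < n -> d y = inl x -> x < m /\ phi x = y).

Lemma row_id m : row m m inl id.
Proof. by split=> [x|y x lty [<-]]. Qed.

(** The origin of the point [z] of the long diagram: a point of the short diagram or an extra block.
    The row number stored with a label keeps the extra blocks of the two rows apart. *)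
Definition ext_pt (n m : nat) (d e : nat -> nat + nat) (z : nat) :=
  if z < n then tag_row 0 0 (d z) else tag_row m 2 (e (z - n)).

Definition ext (N m n n' : nat) (d e : nat -> nat + nat) (P : {set {set 'I_N}}) :
    {set {set 'I_N}} :=
  class_part N (n + n') (fun z => liftc (cls P) (ext_pt n m d e z)).

Lemma ext_partition N m n n' d e (P : {set {set 'I_N}}) :
  partition (ext m n n' d e P) (points N (n + n')).
Proof. exact: class_partP. Qed.

Lemma ext_id N m m' (P : {set {set 'I_N}}) d e :
  (forall y, y < m -> d y = inl y) -> (forall y, y < m' -> e y = inl y) ->
  partition P (points N (m + m')) -> m + m' <= N -> ext m m m' d e P = P.
Proof.
move=> dI eI partP leN; rewrite -[RHS](class_part_cls partP) //.
apply: eq_class_part => // x y ltx lty.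
have ptE z : z < m + m' -> ext_pt m m d e z = inl z.
  move=> ltz; rewrite /ext_pt; case: ltnP => [ltzm|lemz]; first by rewrite dI.
  by rewrite eI /= ?subnKC //; lia.
by rewrite !ptE.
Qed.

(* The rows [e] (upper row of the first factor) and [e2] (lower row of the
   second factor) are glued: [rho] names the resulting connected components,
   each strand lying on its own component and [k] components being loops. *)
Definition compatible (m n k : nat) (e e2 rho : nat -> nat + nat) : Prop :=
  [/\ forall y y', y < n -> y' < n -> e y = e y' \/ e2 y = e2 y' -> rho y = rho y',
      forall y x, y < n -> e y = inl x \/ e2 y = inl x -> rho y = inl x,
      forall y x, y < n -> rho y = inl x -> x < m,
      forall (T : Type) (c : nat -> T),
        (forall y y', y < n -> y' < n -> e y = e y' -> c y = c y') ->
        (forall y y', y < n -> y' < n -> e2 y = e2 y' -> c y = c y') ->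
        forall y y', y < n -> y' < n -> rho y = rho y' -> c y = c y' &
      forall t, (exists2 y, y < n & rho y = inr t) <-> t < k].

Lemma compatible_id m : compatible m m 0 inl inl inl.
Proof.
split=> [y y' _ _ []//|y x _ []//|y x lty [<-] //|T c cP _ y y' lty lty' [<-] //|t].
by split=> // -[].
Qed.

(** * Composition of extended diagrams *)

Section ExtComp.
Variables (N m m' m'' n n' n'' k : nat) (d e e2 d2 rho : nat -> nat + nat).
Variables (phi phi' psi' phi'' : nat -> nat).
Hypotheses (row_d : row m n d phi) (row_e : row m' n' e phi').
Hypotheses (row_e2 : row m' n' e2 psi') (row_d2 : row m'' n'' d2 phi'').
Hypothesis comp_e : compatible m' n' k e e2 rho.
Variables f g : {set {set 'I_N}}.
Hypotheses (partf : partition f (points N (m + m'))).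
Hypotheses (partg : partition g (points N (m' + m''))).
Hypotheses (leN1 : m + m' <= N) (leN2 : m' + m'' <= N) (leN3 : m + m'' <= N).
Hypotheses (leN4 : n + n' <= N) (leN5 : n' + n'' <= N) (leN6 : n + n'' <= N).

Let F := ext m n n' d e f.
Let G := ext m' n' n'' e2 d2 g.
Let small := glue_conn m m' m'' f g.
Let big := glue_conn n n' n'' F G.
Let cS := gcls m m' m'' f g.

(** The colour of a point of the long gluing: a point of the short gluing, an extra block of an
    outer row (0 or 2), or a loop of the glued row (1). *)
Let big_pt z : nat + (nat * nat) :=
  if z < n then tag_row 0 0 (d z) else
  if z < n + n' then tag_row m 1 (rho (z - n)) else
  tag_row (m + m') 2 (d2 (z - n - n')).
Let cB z := liftc cS (big_pt z).
Let sigma x := if x < m then phi x else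
  if x < m + m' then n + phi' (x - m) else n + n' + phi'' (x - m - m').

Let big_ext1 z z' : z < n + n' -> z' < n + n' ->
  liftc (cls f) (ext_pt n m d e z) = liftc (cls f) (ext_pt n m d e z') -> big z z'.
Proof.
move=> ltz ltz' eqzz'; apply: glue_connL => //.
by rewrite blk_class_part // ltz ltz' eqzz' eqxx.
Qed.

Let big_ext2 z z' : z < n' + n'' -> z' < n' + n'' ->
  liftc (cls g) (ext_pt n' m' e2 d2 z) = liftc (cls g) (ext_pt n' m' e2 d2 z') ->
  big (n + z) (n + z').
Proof.
move=> ltz ltz' eqzz'; apply: glue_connR => //.
by rewrite blk_class_part // ltz ltz' eqzz' eqxx.
Qed.

Let ext_pt_top z : n <= z -> ext_pt n m d e z = tag_row m 2 (e (z - n)).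
Proof. by rewrite /ext_pt ltnNge => ->. Qed.
Let ext_pt_top2 z : n' <= z -> ext_pt n' m' e2 d2 z = tag_row m' 2 (d2 (z - n')).
Proof. by rewrite /ext_pt ltnNge => ->. Qed.

Let big_mid y y' : y < n' -> y' < n' -> rho y = rho y' -> big (n + y) (n + y').
Proof.
move=> lty lty' eq_rho; case: comp_e => _ _ _ conn _.
have eq_big : gcls n n' n'' F G (n + y) = gcls n n' n'' F G (n + y').
  apply: (conn _ (fun y => gcls n n' n'' F G (n + y))) => // z z' ltz ltz' eqz;
    apply/eqP; rewrite -gcls_classifies; try lia.
    apply: big_ext1; rewrite ?ltn_add2l //.
    by rewrite !ext_pt_top ?leq_addr // !addKn eqz.
  apply: big_ext2; rewrite ?ltn_addr //.
  by rewrite /ext_pt ltz ltz' eqz.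
by rewrite /big gcls_classifies ?eq_big ?eqxx //; lia.
Qed.

Let sigma_lt x : x < m + m' + m'' -> sigma x < n + n' + n''.
Proof.
move=> ltx; rewrite /sigma; case: ifP => [ltxm|nltxm].
  by have [/(_ _ ltxm)[] + _ _] := row_d; lia.
case: ifP => [ltxm'|nltxm'].
  have ltx' : x - m < m' by lia.
  by have [/(_ _ ltx')[] + _ _] := row_e; lia.
have ltx' : x - m - m' < m'' by lia.
by have [/(_ _ ltx')[] + _ _] := row_d2; lia.
Qed.

Let ext_pt_sigma x : x < m + m' -> ext_pt n m d e (sigma x) = inl x.
Proof.
move=> ltx; rewrite /sigma; case: ifP => [ltxm|nltxm].
  by have [/(_ _ ltxm)[lt_phi d_phi] _] := row_d; rewrite /ext_pt lt_phi d_phi.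
rewrite ltx ext_pt_top ?leq_addr // addKn.
have ltx' : x - m < m' by lia.
by have [/(_ _ ltx')[_ ->] _] := row_e; rewrite /= subnKC //; lia.
Qed.

Let sigma2 x := if x < m' then psi' x else n' + phi'' (x - m').
Let ext_pt_sigma2 x : x < m' + m'' -> ext_pt n' m' e2 d2 (sigma2 x) = inl x.
Proof.
move=> ltx; rewrite /sigma2; case: ifP => [ltxm|nltxm].
  by have [/(_ _ ltxm)[lt_phi d_phi] _] := row_e2; rewrite /ext_pt lt_phi d_phi.
rewrite ext_pt_top2 ?leq_addr // addKn.
have ltx' : x - m' < m'' by lia.
by have [/(_ _ ltx')[_ ->] _] := row_d2; rewrite /= subnKC //; lia.
Qed.

Let sigma2_lt x : x < m' + m'' -> sigma2 x < n' + n''.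
Proof.
move=> ltx; rewrite /sigma2; case: ifP => [ltxm|nltxm].
  by have [/(_ _ ltxm)[] + _ _] := row_e2; lia.
have ltx' : x - m' < m'' by lia.
by have [/(_ _ ltx')[] + _ _] := row_d2; lia.
Qed.

Let sigma1_lt x : x < m + m' -> sigma x < n + n'.
Proof.
move=> ltx; rewrite /sigma; case: ifP => [ltxm|nltxm].
  by have [/(_ _ ltxm)[] + _ _] := row_d; lia.
have ltx' : x - m < m' by lia.
by rewrite ltx; have [/(_ _ ltx')[] + _ _] := row_e; lia.
Qed.

(** A middle strand [x] may sit at different places in the two glued rows, [phi' x] and [psi' x]. As
    [rho] sends both to [x], they are connected. *)
Let big_sigma2 x : x < m' + m'' -> big (sigma (m + x)) (n + sigma2 x).
Proof.
move=> ltx; rewrite /sigma /sigma2 ltn_nge_addr ltn_add2l.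
case: ltnP => [ltxm|lexm]; last first.
  rewrite addKn addnA; apply: glue_conn_refl; have ltx' : x - m' < m'' by lia.
  by have [/(_ _ ltx')[] + _ _] := row_d2; lia.
rewrite addKn.
have [/(_ _ ltxm)[lt1 d1] _] := row_e; have [/(_ _ ltxm)[lt2 d2'] _] := row_e2.
apply: big_mid => //; have [_ rhoI _ _ _] := comp_e.
by rewrite (rhoI _ x) // ?(rhoI _ x) //; [right | left].
Qed.

Let small_big x y : small x y -> big (sigma x) (sigma y).
Proof.
move=> sxy; have [ltx lty] := glue_conn_lt sxy.
rewrite /big gcls_classifies ?sigma_lt //; apply/eqP.
pose c z := gcls n n' n'' F G (sigma z).
apply: (@glue_conn_min _ _ _ _ _ _ _ c) sxy => {x y ltx lty} x y ltx lty bxy; apply/eqP.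
  rewrite -gcls_classifies ?sigma_lt //; try lia.
  apply: big_ext1; rewrite ?sigma1_lt // !ext_pt_sigma //=.
  by congr inl; apply/eqP; rewrite (cls_eq partf).
rewrite -gcls_classifies ?sigma_lt //; try lia.
apply: glue_conn_trans (big_sigma2 ltx) _.
apply: (@glue_conn_trans _ _ _ _ _ _ _ (n + sigma2 y)); last first.
  by rewrite glue_conn_sym; apply: big_sigma2.
apply: big_ext2; rewrite ?sigma2_lt // !ext_pt_sigma2 //=.
by congr inl; apply/eqP; rewrite (cls_eq partg).
Qed.

Let big_ptP z x : z < n + n' + n'' -> big_pt z = inl x ->
  x < m + m' + m'' /\ big z (sigma x).
Proof.
move=> ltz; rewrite /big_pt; case: ifP => [ltzn|nltzn].
  case d_z: (d z) => [x'|//] /= [<-]; rewrite add0n.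
  have [_ /(_ _ _ ltzn d_z)[ltx' phi_x]] := row_d; split; first by lia.
  by rewrite /sigma ltx' phi_x; apply: glue_conn_refl.
case: ifP => [ltzn'|nltzn'].
  case rho_z: (rho (z - n)) => [x'|//] /= [<-].
  have ltz' : z - n < n' by lia.
  have [_ rhoI /(_ _ _ ltz' rho_z) ltx' _ _] := comp_e; split; first by lia.
  rewrite /sigma ltn_nge_addr ltn_add2l ltx' addKn.
  have [/(_ _ ltx')[lt1 d1] _] := row_e.
  have -> : z = n + (z - n) by lia.
  by apply: big_mid => //; rewrite rho_z (rhoI _ x') //; left.
case d_z: (d2 _) => [x'|//] /= [<-].
have ltz' : z - n - n' < n'' by lia.
have [_ /(_ _ _ ltz' d_z)[ltx' phi_x]] := row_d2; split; first by lia.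
have -> : sigma (m + m' + x') = z.
  rewrite /sigma; do 2 (case: ifP => [?|_]; first by exfalso; lia).
  have -> : m + m' + x' - m - m' = x' by lia.
  by rewrite phi_x; lia.
exact: glue_conn_refl.
Qed.

Let ext_pt_big_inl z x : z < n + n' -> ext_pt n m d e z = inl x ->
  x < m + m' /\ big_pt z = inl x.
Proof.
move=> ltz; rewrite /ext_pt /big_pt ltz; case: ifP => [ltzn|nltzn].
  case d_z: (d z) => [x'|//] /= [<-]; rewrite add0n.
  by have [_ /(_ _ _ ltzn d_z)[ltx' _]] := row_d; split; first lia.
case e_z: (e (z - n)) => [x'|//] /= [<-]; have ltz' : z - n < n' by lia.
have [_ /(_ _ _ ltz' e_z)[ltx' _]] := row_e; split; first lia.
by have [_ rhoI _ _ _] := comp_e; rewrite (rhoI _ x') //; left.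
Qed.

Let ext_pt_big_inr z z' l : z < n + n' -> z' < n + n' ->
  ext_pt n m d e z = inr l -> ext_pt n m d e z' = inr l -> big_pt z = big_pt z'.
Proof.
move=> ltz ltz'; rewrite /ext_pt /big_pt ltz ltz'.
case: (ltnP z n) => lezn; case: (ltnP z' n) => lezn'.
- by case: (d z) => // t [<-]; case: (d z') => // t' [->].
- by case: (d z) => // t [<-]; case: (e _).
- by case: (e _) => // t [<-]; case: (d _).
case e_z: (e (z - n)) => [//|t] [<-]; case e_z': (e (z' - n)) => [//|t'] [eq_t].
have [rho_eq _ _ _ _] := comp_e; rewrite (rho_eq _ (z' - n)) //; try lia.
by left; rewrite e_z e_z' eq_t.
Qed.

Let ext_pt2_big_inl z x : z < n' + n'' -> ext_pt n' m' e2 d2 z = inl x ->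
  x < m' + m'' /\ big_pt (n + z) = inl (m + x).
Proof.
move=> ltz; rewrite /ext_pt /big_pt ltn_nge_addr ltn_add2l addKn.
case: ifP => [ltzn|nltzn].
  case e_z: (e2 z) => [x'|//] /= [<-]; rewrite add0n.
  have [_ /(_ _ _ ltzn e_z)[ltx' _]] := row_e2; split; first lia.
  by have [_ rhoI _ _ _] := comp_e; rewrite (rhoI _ x') //; right.
have ltz' : z - n' < n'' by lia.
case d_z: (d2 (z - n')) => [x'|//] /= [<-].
by have [_ /(_ _ _ ltz' d_z)[ltx' _]] := row_d2; rewrite addnA; split; first lia.
Qed.

Let ext_pt2_big_inr z z' l : z < n' + n'' -> z' < n' + n'' ->
  ext_pt n' m' e2 d2 z = inr l -> ext_pt n' m' e2 d2 z' = inr l ->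
  big_pt (n + z) = big_pt (n + z').
Proof.
move=> ltz ltz'; rewrite /ext_pt /big_pt !ltn_nge_addr !ltn_add2l !addKn.
case: (ltnP z n') => lezn; case: (ltnP z' n') => lezn'.
- case e_z: (e2 z) => [//|t] [<-]; case e_z': (e2 z') => [//|t'] [eq_t].
  have [rho_eq _ _ _ _] := comp_e; rewrite (rho_eq _ z') //.
  by right; rewrite e_z e_z' eq_t.
- by case: (e2 z) => // t [<-]; case: (d2 _).
- by case: (d2 _) => // t [<-]; case: (e2 _).
by case: (d2 _) => // t [<-]; case: (d2 _) => // t' [->].
Qed.

(** Connected points share a colour by minimality of the connection, [cB] being constant on the
    blocks of [F] and [G]. Conversely, points of equal colour are joined through the short gluing
    ([inl]), or within an extra block or a component of the glued row ([inr]). *)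
Let cB_classifies : classifies n n' n'' F G cB.
Proof.
move=> z z' ltz ltz'; apply/idP/eqP => [|eqc].
  apply: glue_conn_min => {z z' ltz ltz'} z z' ltz ltz'; rewrite blk_class_part //;
      case/and3P=> _ _ /eqP.
    case def_z: (ext_pt n m d e z) => [x|l]; case def_z': (ext_pt n m d e z') => [x'|l'] //=.
      have [[ltx ptz] [ltx' ptz']] := (ext_pt_big_inl ltz def_z, ext_pt_big_inl ltz' def_z').
      case=> /eqP; rewrite (cls_eq partf) // => bxx'.
      rewrite /cB ptz ptz' /=; congr inl; apply/eqP.
      by rewrite -gcls_classifies; [apply: glue_connL | lia | lia].
    case=> eql; rewrite /cB (@ext_pt_big_inr z z' l) //.
    by rewrite def_z' eql.
  case def_z: (ext_pt n' m' e2 d2 z) => [x|l];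
    case def_z': (ext_pt n' m' e2 d2 z') => [x'|l'] //=.
    have [[ltx ptz] [ltx' ptz']] := (ext_pt2_big_inl ltz def_z, ext_pt2_big_inl ltz' def_z').
    case=> /eqP; rewrite (cls_eq partg) // => bxx'.
    rewrite /cB ptz ptz' /=; congr inl; apply/eqP.
    by rewrite -gcls_classifies; [apply: glue_connR | lia | lia].
  case=> eql; rewrite /cB (@ext_pt2_big_inr z z' l) //.
  by rewrite def_z' eql.
move: eqc; rewrite /cB.
case def_z: (big_pt z) => [x|l]; case def_z': (big_pt z') => [x'|l'] //=.
  have [[ltx bz] [ltx' bz']] := (big_ptP ltz def_z, big_ptP ltz' def_z').
  case=> /eqP; rewrite -gcls_classifies // => sxx'.
  apply: glue_conn_trans bz _; apply: glue_conn_trans (small_big sxx') _.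
  by rewrite glue_conn_sym.
case=> eql; move: def_z def_z'; rewrite -{l'}eql /big_pt.
case: (ltnP z n) => [ltzn|lezn]; [|case: (ltnP z (n + n')) => lezn2].
- case: (ltnP z' n) => [ltzn'|lezn']; 
    [|by case: ifP => _; case: (d z) => // t [<-]; [case: (rho _) | case: (d2 _)]].
  move=> d_z d_z'; apply: big_ext1; rewrite ?ltn_addr //.
  by rewrite /ext_pt ltzn ltzn' d_z d_z'.
- case: (ltnP z' n) => [ltzn'|lezn']; first by case: (rho _) => // t [<-]; case: (d _).
  case: ifP => [ltzn2'|_]; last by case: (rho _) => // t [<-]; case: (d2 _).
  case r_z: (rho (z - n)) => [//|t] [<-]; case r_z': (rho (z' - n)) => [//|t'] [eqt].
  rewrite -(subnKC lezn) -(subnKC lezn'); apply: big_mid; try lia.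
  by rewrite r_z r_z' eqt.
case: (ltnP z' n) => [ltzn'|lezn']; first by case: (d2 _) => // t [<-]; case: (d _).
case: ifP => [ltzn2'|lezn2']; first by case: (d2 _) => // t [<-]; case: (rho _).
case d_z: (d2 (z - n - n')) => [//|t] [<-]; case d_z': (d2 (z' - n - n')) => [//|t'] [eqt].
rewrite -(subnKC lezn) -(subnKC lezn'); apply: big_ext2; try lia.
by rewrite !ext_pt_top2; try lia; rewrite d_z d_z' eqt.
Qed.

Let emb_cB z : z < n + n'' ->
  big_pt (emb n n' z) = match ext_pt n m d d2 z with
                        | inl x => inl (emb m m' x) | inr l => inr l end.
Proof.
move=> ltz; rewrite /emb /ext_pt /big_pt; case: (ltnP z n) => [ltzn|lezn].
  rewrite ltzn; case d_z: (d z) => [x|//] /=.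
  by have [_ /(_ _ _ ltzn d_z)[ltx _]] := row_d; rewrite add0n ltx.
do 2 (case: ifP => [?|_]; first by exfalso; lia).
have -> : z + n' - n - n' = z - n by lia.
case: (d2 _) => [x|//] /=; case: ifP => [?|_]; first by exfalso; lia.
by congr inl; lia.
Qed.

Let ext_dcomp : dcomp n n' n'' F G = ext m n n'' d d2 (dcomp m m' m'' f g).
Proof.
rewrite (dcomp_class_part cB_classifies) //.
apply: eq_class_part => // x y ltx lty; rewrite /cB !emb_cB //.
have lt_pt z w : z < n + n'' -> ext_pt n m d d2 z = inl w -> w < m + m''.
  move=> ltz; rewrite /ext_pt; case: ifP => [ltzn|nltzn].
    case d_z: (d z) => [x'|//] /= [<-]; rewrite add0n.
    by have [_ /(_ _ _ ltzn d_z)[ltx' _]] := row_d; lia.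
  have ltz' : z - n < n'' by lia.
  case d_z: (d2 (z - n)) => [x'|//] /= [<-].
  by have [_ /(_ _ _ ltz' d_z)[ltx' _]] := row_d2; lia.
rewrite (dcomp_class_part (@gcls_classifies N m m' m'' f g)) //.
case def_x: (ext_pt n m d d2 x) => [x'|l]; case def_y: (ext_pt n m d d2 y) => [y'|l'] //=.
rewrite /eq_op /= (cls_eq (class_partP _ _ _)) ?blk_class_part //;
  try by [apply: lt_pt def_x | apply: lt_pt def_y].
by rewrite (lt_pt x) ?(lt_pt y).
Qed.

(** The loops of the long gluing are those of the short one, coloured [inl], and the [k] components
    of the glued row that carry no strand, coloured [inr (1, t)]. *)
Let ext_dloops : dloops n n' n'' F G = dloops m m' m'' f g + k.
Proof.
rewrite (dloops_mid_classes cB_classifies).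
rewrite (dloops_mid_classes (@gcls_classifies N m m' m'' f g)) -/cS.
set s := undup (mid_classes m m' m'' cS).
transitivity (size ([seq inl x | x <- s] ++ [seq inr (1, t) | t <- iota 0 k] :
   seq ({set 'I_(m + m' + m'')} + nat * nat))); last by rewrite size_cat !size_map size_iota.
have [_ rhoI rho_lt _ rhoL] := comp_e.
apply/perm_size/uniq_perm; rewrite ?undup_uniq //.
  rewrite cat_uniq !map_inj_uniq ?undup_uniq ?iota_uniq /= ?andbT; last 2 first.
  - by move=> x y [].
  - by move=> x y [].
  by apply/hasPn=> ? /mapP[t _ ->]; apply/mapP=> -[].
move=> c; rewrite mem_undup mem_cat; apply/mapP/orP => [[z]|].
  rewrite mem_filter mem_iota => /andP[/allP outz midz] ->.
  have midz' : z - n < n' by lia.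
  have ptz : big_pt z = tag_row m 1 (rho (z - n)).
    have nltz : (z < n) = false by lia.
    have ltz : z < n + n' by lia.
    by rewrite /big_pt nltz ltz.
  rewrite /cB ptz; case rho_z: (rho (z - n)) => [x|t]; [left|right].
    apply/map_f; rewrite mem_undup; apply: map_f.
    have ltx := rho_lt _ _ midz' rho_z; rewrite mem_filter.
    apply/andP; split; last by rewrite mem_iota; lia.
    apply/allP=> y; rewrite mem_cat !mem_iota => outy; apply/negP=> /eqP eqc.
    have lty : y < m + m' + m'' by lia.
    (* If an outer point [y] of the short gluing had the colour of [z], then [sigma y] would be an
       outer point connected to [z]. *)
    have outsy : sigma y \in iota 0 n ++ iota (n + n') n''.
      rewrite mem_cat !mem_iota; have := sigma_lt lty; rewrite /sigma.
      by case: ifP => [ltym|nltym]; [have [/(_ _ ltym)[]] := row_d | case: ifP]; lia.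
    case/negP: (outz _ outsy); rewrite -cB_classifies ?sigma_lt //; try lia.
    have ltmx : m + x < m + m' + m'' by lia.
    have /small_big : small y (m + x) by rewrite /small gcls_classifies //; apply/eqP.
    move/glue_conn_trans; apply; rewrite glue_conn_sym.
    have /big_ptP[] // : big_pt z = inl (m + x) by rewrite ptz rho_z.
    by lia.
  apply: map_f; rewrite mem_iota add0n; apply/rhoL; by exists (z - n).
case=> /mapP[x]; last first.
  rewrite mem_iota add0n => /rhoL[y lty rho_y] ->; exists (n + y); last first.
    rewrite /cB /big_pt ltn_nge_addr ltn_add2l lty addKn rho_y //.
  rewrite mem_filter; apply/andP; split; last by rewrite mem_iota; lia.
  apply/allP=> z outz.
  rewrite /cB /big_pt !ltn_nge_addr ltn_add2l lty addKn rho_y /=.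
  move: outz; rewrite mem_cat !mem_iota.
  by case: ifP => [_|nltz]; [case: (d z) | case: ifP => [|_]; [lia | case: (d2 _)]].
rewrite mem_undup => /mapP[y]; rewrite mem_filter mem_iota => /andP[/allP outy midy] -> ->.
have lty : y < m + m' + m'' by lia.
have lty' : y - m < m' by lia.
have [/(_ _ lty')[lt_phi e_phi] _] := row_e.
have pt_sy : big_pt (sigma y) = inl y.
  rewrite /sigma; case: ifP => [|_]; first lia; case: ifP => [_|]; last lia.
  rewrite /big_pt ltn_nge_addr ltn_add2l lt_phi addKn (rhoI _ (y - m)) //=.
    by rewrite subnKC //; lia.
  by left.
exists (sigma y); last by rewrite /cB pt_sy.
rewrite mem_filter mem_iota; apply/andP; split; last first.
  by rewrite /sigma; case: ifP => [|_]; [lia | case: ifP => [_|]; lia].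
apply/allP=> z; rewrite mem_cat !mem_iota => outz; apply/negP.
rewrite /cB pt_sy; case pt_z: (big_pt z) => [w|//] /eqP [eqc].
have ltz : z < n + n' + n'' by lia.
have [ltw _] := big_ptP ltz pt_z.
have outw : w \in iota 0 m ++ iota (m + m') m''.
  rewrite mem_cat !mem_iota; move: pt_z; rewrite /big_pt; case: ifP => [ltzn|nltzn].
    case d_z: (d z) => [x'|//] /= [<-].
    by have [_ /(_ _ _ ltzn d_z)[ltx' _]] := row_d; lia.
  case: ifP => [?|_]; first by exfalso; lia.
  have ltz' : z - n - n' < n'' by lia.
  case d_z: (d2 _) => [x'|//] /= [<-].
  by have [_ /(_ _ _ ltz' d_z)[ltx' _]] := row_d2; lia.
by have := outy _ outw; rewrite eqc eqxx.
Qed.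

(** The relations for [f v], [u (f v)], [v u] and [(u g v)(u f v)] are all instances: a row that is
    not lengthened is taken with [inl] and [id], and gluing two such rows adds no loop. *)
Lemma ext_comp : dcomp n n' n'' F G = ext m n n'' d d2 (dcomp m m' m'' f g) /\
  dloops n n' n'' F G = dloops m m' m'' f g + k.
Proof. exact: conj ext_dcomp ext_dloops. Qed.

End ExtComp.

(** * Identity diagrams and the unit laws *)

Section Identity.
Variable N : nat.
Implicit Types P : {set {set 'I_N}}.

(** Both ends of a vertical line of the identity get the same number; above the first row it is the
    shift by [a], which renumbers the points of a diagram glued on top of the identity. *)
Definition fold_row (a x : nat) : nat := if x < a then x else x - a.

Lemma idpart_class_part a : a + a <= N ->
  idpart N a = class_part N (a + a) (fold_row a).
Proof.
move=> leN; have fold_lt x : x < a + a -> fold_row a x < a.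
  by rewrite /fold_row; case: ifP; lia.
have setE (u : 'I_N) (k : nat) : k < a -> fold_row a u = k ->
    [set x : 'I_N | (val x == k) || (val x == a + k)] =
    [set v in points N (a + a) | fold_row a u == fold_row a v].
  move=> ltk fu; apply/setP=> v; rewrite !inE fu /fold_row /=.
  by case: ifP => ltva; apply/idP/idP; lia.
apply/setP=> B; apply/imsetP/imsetP => -[u]; rewrite inE => ltu ->.
  by exists u; [rewrite inE; lia | apply: setE => //; rewrite /fold_row ltu].
have ltfN : fold_row a u < N by have := fold_lt _ ltu; lia.
exists (Ordinal ltfN); first by rewrite inE /= fold_lt.
by rewrite (setE u (fold_row a u)) ?fold_lt.
Qed.

Lemma idpart_partition a : a + a <= N -> partition (idpart N a) (points N (a + a)).
Proof. by move=> leN; rewrite idpart_class_part // class_partP. Qed.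

Lemma blk_idpart a x y : a + a <= N ->
  blk (idpart N a) x y = [&& x < a + a, y < a + a & fold_row a x == fold_row a y].
Proof. by move=> leN; rewrite idpart_class_part // blk_class_part. Qed.

Section Laws.
Variables (a b : nat) (P : {set {set 'I_N}}).
Hypotheses (partP : partition P (points N (a + b))) (leN : a + b <= N).

Lemma id_classifies_l : a + a <= N ->
  classifies a a b (idpart N a) P (fun z => cls P (fold_row a z)).
Proof.
move=> leaN z z' ltz ltz'; apply/idP/eqP => [|eqc].
  apply: (@glue_conn_min _ _ _ _ _ _ _ (fun z => cls P (fold_row a z)))
    => {z z' ltz ltz'} x y ltx lty /=.
    by rewrite blk_idpart // => /and3P[_ _ /eqP->].
  move=> bxy; rewrite /fold_row !ltn_nge_addr !addKn.
  by apply/eqP; rewrite (cls_eq partP).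
have to_mid x : x < a + a + b -> glue_conn a a b (idpart N a) P x (a + fold_row a x).
  rewrite /fold_row; case: ifP => ltxa ltx; last first.
    by rewrite subnKC; [exact: glue_conn_refl | lia].
  apply: glue_connL; try lia; rewrite blk_idpart // /fold_row ltxa ltn_nge_addr addKn.
  by rewrite eqxx !andbT; lia.
apply: glue_conn_trans (to_mid _ ltz) _; rewrite glue_conn_sym.
apply: glue_conn_trans (to_mid _ ltz') _; rewrite glue_conn_sym.
have fold_lt x : x < a + a + b -> fold_row a x < a + b.
  by rewrite /fold_row; case: ifP; lia.
by apply: glue_connR; rewrite ?fold_lt // -(cls_eq partP) ?fold_lt ?eqc.
Qed.

Lemma id_classifies_r : b + b <= N ->
  classifies a b b P (idpart N b) (fun z => cls P (if z < a + b then z else z - b)).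
Proof.
move=> lebN z z' ltz ltz'; apply/idP/eqP => [|eqc].
  apply: (@glue_conn_min _ _ _ _ _ _ _
    (fun z => cls P (if z < a + b then z else z - b))) => {z z' ltz ltz'} x y ltx lty /=.
    by rewrite ltx lty => bxy; apply/eqP; rewrite (cls_eq partP).
  rewrite blk_idpart // => /and3P[_ _ /eqP].
  have foldE w : w < b + b -> (if a + w < a + b then a + w else a + w - b) = a + fold_row b w.
    by rewrite /fold_row ltn_add2l; case: ifP; lia.
  by move=> eqf; rewrite !foldE // eqf.
pose h z := if z < a + b then z else z - b.
have to_mid x : x < a + b + b -> glue_conn a b b P (idpart N b) x (h x).
  rewrite /h; case: ifP => ltxa ltx; first exact: glue_conn_refl.
  have -> : x = a + (x - a) by lia.
  have -> : a + (x - a) - b = a + (x - a - b) by lia.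
  apply: glue_connR; try lia; rewrite blk_idpart // /fold_row.
  have -> : (x - a < b) = false by lia.
  have -> : (x - a - b < b) = true by lia.
  by rewrite eqxx; lia.
have h_lt x : x < a + b + b -> h x < a + b by rewrite /h; case: ifP; lia.
apply: glue_conn_trans (to_mid _ ltz) _; rewrite glue_conn_sym.
apply: glue_conn_trans (to_mid _ ltz') _; rewrite glue_conn_sym.
by apply: glue_connL; rewrite ?h_lt // -(cls_eq partP) ?h_lt // -/(h z) eqc.
Qed.

Lemma dcomp_id_l : a + a <= N -> dcomp a a b (idpart N a) P = P.
Proof.
move=> leaN; rewrite (dcomp_class_part (id_classifies_l leaN)) //.
rewrite -[RHS](class_part_cls partP) //; apply: eq_class_part => // x y ltx lty.
have foldE z : fold_row a (emb a a z) = z.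
  by rewrite /fold_row /emb; case: (ltnP z a) => [->//|leaz]; case: ifP; lia.
by rewrite !foldE.
Qed.

Lemma dcomp_id_r : b + b <= N -> dcomp a b b P (idpart N b) = P.
Proof.
move=> lebN; rewrite (dcomp_class_part (id_classifies_r lebN)) //.
rewrite -[RHS](class_part_cls partP) //; apply: eq_class_part => // x y ltx lty.
have foldE z : (if emb a b z < a + b then emb a b z else emb a b z - b) = z.
  by rewrite /emb; case: (ltnP z a) => ?; case: ifP; lia.
by rewrite !foldE.
Qed.

(** Each middle point is joined by the identity to an outer point, so no component stays in the
    middle. *)
Lemma dloops_id_l : a + a <= N -> dloops a a b (idpart N a) P = 0.
Proof.
move=> leaN; rewrite (dloops_mid_classes (id_classifies_l leaN)) /mid_classes.
rewrite (@eq_in_filter _ _ pred0) ?filter_pred0 // => x; rewrite mem_iota => midx /=.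
apply/negbTE/allPn; exists (x - a); first by rewrite mem_cat mem_iota; lia.
rewrite negbK /fold_row; have -> : (x < a) = false by lia.
by have -> : (x - a < a) = true by lia.
Qed.

Lemma dloops_id_r : b + b <= N -> dloops a b b P (idpart N b) = 0.
Proof.
move=> lebN; rewrite (dloops_mid_classes (id_classifies_r lebN)) /mid_classes.
rewrite (@eq_in_filter _ _ pred0) ?filter_pred0 // => x; rewrite mem_iota => midx /=.
apply/negbTE/allPn; exists (x + b); first by rewrite mem_cat !mem_iota; lia.
rewrite negbK; have -> : (x < a + b) = true by lia.
have -> : (x + b < a + b) = false by lia.
by rewrite addnK.
Qed.

End Laws.

Lemma dcomp_partition i j k P (Q : {set {set 'I_N}}) : i + k <= N ->
  partition (dcomp i j k P Q) (points N (i + k)).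
Proof. by move=> leN; rewrite (dcomp_class_part (@gcls_classifies _ _ _ _ _ _)) // class_partP. Qed.

End Identity.

(** * Category algebras *)

Section CatMorita.
Variables (K : fieldType) (delta : K) (N : nat).
Variable al : nat -> nat -> {set {set 'I_N}} -> bool.

Section Basis.
Variable objs : seq nat.

(* [cat_alg] with ['I_N] for an explicit [N]: the values of [Nof] on the two
   lists of objects are equal but not convertible. *)
Definition basis_pred (t : 'I_N.+1 * 'I_N.+1 * {set {set 'I_N}}) : bool :=
  let: (a, b, P) := t in
  [&& (a : nat) \in objs, (b : nat) \in objs, is_diag a b P & al a b P].

Definition basis : finType :=
  {t : 'I_N.+1 * 'I_N.+1 * {set {set 'I_N}} | basis_pred t}.

Definition basis_mul (x y z : basis) : K :=
  let: (b, c, Q) := val x in let: (a, b', P) := val y in let: (a', c', R) := val z in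
  if [&& (b == b' :> nat), (a' == a :> nat), (c' == c :> nat) & R == dcomp a b c P Q]
  then (delta ^+ dloops a b c P Q)%R else 0%R.

Definition basis_one (z : basis) : K :=
  let: (a, b, R) := val z in
  if (a == b :> nat) && (R == idpart N a) then 1%R else 0%R.

Definition cat_algN : fdalg K := FdAlg basis_mul basis_one.

Definition dom (z : basis) : nat := (val z).1.1.
Definition cod (z : basis) : nat := (val z).1.2.
Definition dia (z : basis) : {set {set 'I_N}} := (val z).2.

Lemma basisP (z : basis) : [/\ dom z \in objs, cod z \in objs,
  is_diag (dom z) (cod z) (dia z) & al (dom z) (cod z) (dia z)].
Proof. by case: z => -[[a b] P] Pz; have /and4P[] := Pz. Qed.

Lemma basis_inj (z z' : basis) :
  dom z = dom z' -> cod z = cod z' -> dia z = dia z' -> z = z'.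
Proof.
case: z => -[[a b] P] Pz; case: z' => -[[a' b'] P'] Pz'; rewrite /dom /cod /dia /=.
by move=> ea eb eP; apply: val_inj => /=; congr (_, _, _); rewrite //; apply: val_inj.
Qed.

Lemma basis_eqE (z z' : basis) :
  (z == z') = [&& dom z == dom z', cod z == cod z' & dia z == dia z'].
Proof.
apply/eqP/and3P => [->|[/eqP ? /eqP ? /eqP ?]]; first by rewrite !eqxx.
exact: basis_inj.
Qed.

Lemma basis_mulE (x y z : basis) : basis_mul x y z =
  if [&& dom x == cod y, dom z == dom y, cod z == cod x &
         dia z == dcomp (dom y) (dom x) (cod x) (dia y) (dia x)]
  then (delta ^+ dloops (dom y) (dom x) (cod x) (dia y) (dia x))%R else 0%R.
Proof.
by case: x => -[[b c] Q] Px; case: y => -[[a b'] P] Py; case: z => -[[a' c'] R] Pz.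
Qed.

Lemma basis_oneE (z : basis) : basis_one z =
  if (dom z == cod z) && (dia z == idpart N (dom z)) then 1%R else 0%R.
Proof. by case: z => -[[a b] R] Pz. Qed.

Lemma basis_mul_is (x y z : basis) a b c P Q l :
  dom y = a -> cod y = b -> dia y = P -> dom x = b -> cod x = c -> dia x = Q ->
  dom z = a -> cod z = c -> dia z = dcomp a b c P Q -> dloops a b c P Q = l ->
  @prod_is K cat_algN x y (delta ^+ l)%R z.
Proof.
move=> dy cy Py dx cx Qx dz cz eqz <- t /=; rewrite basis_mulE basis_eqE.
by rewrite dx cy eqxx /= dz cz eqz dy cx Py Qx.
Qed.

(** No basis element carries a composite outside the class, so all structure constants vanish. *)
Lemma basis_mul_zero (x y : basis) a b c P Q :
  dom y = a -> cod y = b -> dia y = P -> dom x = b -> cod x = c -> dia x = Q ->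
  ~~ al a c (dcomp a b c P Q) -> @prod_zero K cat_algN x y.
Proof.
move=> dy cy Py dx cx Qx nal t /=; rewrite basis_mulE dx cy eqxx dy cx Py Qx /=.
case: ifP => // /and3P[/eqP dz /eqP cz /eqP eqz].
by have [_ _ _] := basisP t; rewrite eqz dz cz (negbTE nal).
Qed.

Lemma basis_mul_disc (x y : basis) : dom x != cod y -> @prod_zero K cat_algN x y.
Proof. by move=> ne t /=; rewrite basis_mulE (negbTE ne). Qed.

Hypothesis objs_lt : forall m, m \in objs -> m <= N.

Lemma mk_subproof a b P : [/\ a \in objs, b \in objs, is_diag a b P & al a b P] ->
  basis_pred (inord a : 'I_N.+1, inord b : 'I_N.+1, P).
Proof. by case=> oa ob dP alP; rewrite /= !inordK ?ltnS ?objs_lt ?oa ?ob ?dP. Qed.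

Definition mk a b P (h : [/\ a \in objs, b \in objs, is_diag a b P & al a b P]) : basis :=
  Sub (inord a, inord b, P) (mk_subproof h).

Lemma dom_mk a b P h : dom (@mk a b P h) = a.
Proof. by case: h => oa *; rewrite /dom SubK /= inordK // ltnS objs_lt. Qed.

Lemma cod_mk a b P h : cod (@mk a b P h) = b.
Proof. by case: h => oa ob *; rewrite /cod SubK /= inordK // ltnS objs_lt. Qed.

Lemma dia_mk a b P h : dia (@mk a b P h) = P.
Proof. by rewrite /dia SubK. Qed.

End Basis.

Variables (objs : seq nat) (n : nat).
(** For an object [m], the row [U m] carries the extra blocks of [u_m] and [V m] those of [v_m];
    [rho m] describes their gluing and [k m] counts its loops. *)
Variables (U V rho : nat -> nat -> nat + nat) (phi psi : nat -> nat -> nat) (k : nat -> nat).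
Hypothesis n_objs : n \in objs.
Hypothesis N2n : N = n.*2.
Hypothesis objs_le_n : forall m, m \in objs -> m <= n.
Hypothesis rowU : forall m, m \in objs -> row m n (U m) (phi m).
Hypothesis rowV : forall m, m \in objs -> row m n (V m) (psi m).
Hypothesis compUV : forall m, m \in objs -> compatible m n (k m) (U m) (V m) (rho m).
(** On the largest object both rows are bare, so that extension leaves diagrams [n -> n]
    unchanged. *)
Hypothesis U_n : forall y, y < n -> U n y = inl y.
Hypothesis V_n : forall y, y < n -> V n y = inl y.
Hypothesis k_n : k n = 0.
Hypothesis delta_k : forall m, m \in objs -> (delta ^+ k m != 0)%R.
Hypothesis al_id : forall m, m \in objs -> al m m (idpart N m).
(** The direction from the extended diagram back to [P] makes the products of [g], [f] and of their
    extensions vanish together when the composite is not allowed. *)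
Hypothesis al_extUV : forall m m' P, m \in objs -> m' \in objs -> is_diag m m' P ->
  al n n (ext m n n (V m) (U m') P) = al m m' P.
Hypothesis al_extV : forall m m' P, m \in objs -> m' \in objs -> is_diag m m' P ->
  al m m' P -> al n m' (ext m n m' (V m) inl P).
Hypothesis al_extU : forall m m' P, m \in objs -> m' \in objs -> is_diag m m' P ->
  al m m' P -> al m n (ext m m n inl (U m') P).

Let Obj : finType := {m : 'I_N.+1 | (m : nat) \in objs}.
Local Notation B := (basis objs).
Local Notation A := (basis [:: n]).

Let ob (o : Obj) : nat := val (val o).
Let obP (o : Obj) : ob o \in objs. Proof. exact: (valP o). Qed.

Let objs_leN m : m \in objs -> m <= N.
Proof. by move/objs_le_n; rewrite N2n; lia. Qed.

Let objs_leNN m m' : m \in objs -> m' \in objs -> m + m' <= N.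
Proof. by move=> /objs_le_n ? /objs_le_n ?; rewrite N2n; lia. Qed.

Let inO m (h : m \in objs) : Obj.
Proof. by exists (inord m); rewrite inordK // ltnS objs_leN. Defined.

Let ob_inO m (h : m \in objs) : ob (inO h) = m.
Proof. by rewrite /ob /= inordK // ltnS objs_leN. Qed.

Let ob_inj : injective ob.
Proof. by move=> o o' /val_inj/val_inj. Qed.

Let A_leN m : m \in [:: n] -> m <= N.
Proof. by rewrite inE => /eqP->; apply: objs_leN. Qed.

Let src (z : B) : Obj. Proof. by apply: (@inO (dom z)); case: (basisP z). Defined.
Let tgt (z : B) : Obj. Proof. by apply: (@inO (cod z)); case: (basisP z). Defined.
Let ob_src z : ob (src z) = dom z. Proof. exact: ob_inO. Qed.
Let ob_tgt z : ob (tgt z) = cod z. Proof. exact: ob_inO. Qed.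

Let idx_ok (o : Obj) : [/\ ob o \in objs, ob o \in objs,
  is_diag (ob o) (ob o) (idpart N (ob o)) & al (ob o) (ob o) (idpart N (ob o))].
Proof. by split; rewrite ?obP ?al_id ?obP //; apply: idpart_partition; apply: objs_leNN. Qed.
Let idx o := mk objs_leN (idx_ok o).

Let idp m (h : m \in objs) : is_diag m m (idpart N m).
Proof. by apply: idpart_partition; apply: objs_leNN. Qed.

Let u_ok (o : Obj) : [/\ ob o \in objs, n \in objs,
  is_diag (ob o) n (ext (ob o) (ob o) n inl (U (ob o)) (idpart N (ob o))) &
  al (ob o) n (ext (ob o) (ob o) n inl (U (ob o)) (idpart N (ob o)))].
Proof.
by split; rewrite ?obP //; [exact: ext_partition | apply: al_extU; rewrite ?al_id ?idp ?obP].
Qed.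
Let u o := mk objs_leN (u_ok o).

Let v_ok (o : Obj) : [/\ n \in objs, ob o \in objs,
  is_diag n (ob o) (ext (ob o) n (ob o) (V (ob o)) inl (idpart N (ob o))) &
  al n (ob o) (ext (ob o) n (ob o) (V (ob o)) inl (idpart N (ob o)))].
Proof.
by split; rewrite ?obP //; [exact: ext_partition | apply: al_extV; rewrite ?al_id ?idp ?obP].
Qed.
Let v o := mk objs_leN (v_ok o).

Let iota_ok (x : A) : [/\ dom x \in objs, cod x \in objs,
  is_diag (dom x) (cod x) (dia x) & al (dom x) (cod x) (dia x)].
Proof. by have [] := basisP x; rewrite !inE => /eqP-> /eqP->; split. Qed.
Let inc x := mk objs_leN (iota_ok x).

Let ext_ok (z : B) : [/\ n \in [:: n], n \in [:: n],
  is_diag n n (ext (dom z) n n (V (dom z)) (U (cod z)) (dia z)) &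
  al n n (ext (dom z) n n (V (dom z)) (U (cod z)) (dia z))].
Proof.
have [od oc dz az] := basisP z.
by split; rewrite ?inE //; [exact: ext_partition | rewrite al_extUV].
Qed.
Let extb z : A := mk A_leN (ext_ok z).

Let hext_ok (z : B) : [/\ n \in objs, cod z \in objs,
  is_diag n (cod z) (ext (dom z) n (cod z) (V (dom z)) inl (dia z)) &
  al n (cod z) (ext (dom z) n (cod z) (V (dom z)) inl (dia z))].
Proof.
have [od oc dz az] := basisP z.
by split; rewrite ?inE //; [exact: ext_partition | rewrite al_extV].
Qed.
Let hextb z : B := mk objs_leN (hext_ok z).

Let mkE := (dom_mk, cod_mk, dia_mk).
Let A_dom (x : A) : dom x = n. Proof. by case: (basisP x); rewrite inE => /eqP. Qed.
Let A_cod (x : A) : cod x = n. Proof. by case: (basisP x) => _; rewrite inE => /eqP. Qed.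

Let i0_ok : [/\ n \in [:: n], n \in [:: n], is_diag n n (idpart N n) & al n n (idpart N n)].
Proof. by split; rewrite ?inE ?eqxx ?idp ?al_id. Qed.
Let i0 : A := mk A_leN i0_ok.

Let ext_ii m m' (P : {set {set 'I_N}}) : m \in objs -> m' \in objs -> is_diag m m' P ->
  ext m m m' inl inl P = P.
Proof. by move=> om om' dP; apply: ext_id => //; apply: objs_leNN. Qed.

Theorem cat_morita : morita_equiv (cat_algN [:: n]) (cat_algN objs).
Proof.
apply: (@retract_morita K (cat_algN [:: n]) (cat_algN objs) Obj (inO n_objs)
  src tgt idx u v inc extb hextb (fun o => (delta ^+ k (ob o))%R) i0).
- by move=> o; apply: delta_k; apply: obP.
- by rewrite ob_inO k_n.
- move=> x; rewrite /= basis_oneE basis_eqE A_dom A_cod /i0 !mkE.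
  by rewrite eqxx.
- move=> z; rewrite /= basis_oneE basis_eqE /idx !mkE ob_src eqxx /=.
  by rewrite eq_sym.
- by move=> o; apply: ob_inj; rewrite ob_src /idx mkE.
- by move=> o; apply: ob_inj; rewrite ob_tgt /idx mkE.
- by move=> o; apply: ob_inj; rewrite ob_src /u mkE.
- by move=> o; apply: ob_inj; rewrite ob_tgt /u mkE ob_inO.
- by move=> o; apply: ob_inj; rewrite ob_tgt /v mkE.
- by move=> x; apply: ob_inj; rewrite ob_src /inc mkE ob_inO A_dom.
- by move=> x; apply: ob_inj; rewrite ob_tgt /inc mkE ob_inO A_cod.
- by apply: basis_inj; rewrite /inc /i0 /idx !mkE ob_inO.
- move=> x; apply: basis_inj; rewrite /extb /inc !mkE ?A_dom ?A_cod //.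
  have [_ _ dx _] := basisP x; rewrite A_dom A_cod in dx.
  by apply: ext_id => //; apply: objs_leNN.
- move=> g f ne_gf; apply: basis_mul_disc.
  by rewrite -ob_src -ob_tgt (inj_eq ob_inj).
- move=> f; have [od oc df _] := basisP f; rewrite -(expr0 delta).
  apply: (@basis_mul_is objs _ _ _ (dom f) (cod f) (cod f) (dia f) (idpart N (cod f)));
    rewrite /idx ?mkE ?ob_tgt ?dcomp_id_r ?dloops_id_r ?objs_leNN //.
- move=> f; have [od oc df _] := basisP f; rewrite -(expr0 delta).
  apply: (@basis_mul_is objs _ _ _ (dom f) (dom f) (cod f) (idpart N (dom f)) (dia f));
    rewrite /idx ?mkE ?ob_src ?dcomp_id_l ?dloops_id_l ?objs_leNN //.
(* Both algebras compose diagrams [n -> n] in the same way; the alternative is whether the composite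
   is allowed. *)
- move=> x y; pose Q := dcomp n n n (dia y) (dia x).
  have [alQ|nalQ] := boolP (al n n Q); [left | right].
    have hz : [/\ n \in [:: n], n \in [:: n], is_diag n n Q & al n n Q].
      by split; rewrite ?inE ?eqxx //; apply: dcomp_partition; apply: objs_leNN.
    exists (delta ^+ dloops n n n (dia y) (dia x))%R, (mk A_leN hz).
    by split; apply: (@basis_mul_is _ _ _ _ n n n (dia y) (dia x));
      rewrite /inc ?mkE ?A_dom ?A_cod.
  by split; apply: (@basis_mul_zero _ _ _ n n n (dia y) (dia x));
    rewrite /inc ?mkE ?A_dom ?A_cod.
- move=> g f /(congr1 ob); rewrite ob_src ob_tgt => egf.
  have [odf ocf df af] := basisP f; have [odg ocg dg ag] := basisP g.
  rewrite egf in odg dg ag.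
  pose Q := dcomp (dom f) (cod f) (cod g) (dia f) (dia g).
  have dQ : is_diag (dom f) (cod g) Q by apply: dcomp_partition; apply: objs_leNN.
  (* The rows [U] and [V] of the middle object are glued, which adds [k (cod f)] loops: the exponent
     in [w (tgt f)]. *)
  have [extQ loopsQ] := ext_comp (rowV odf) (rowU ocf) (rowV ocf) (rowU ocg) (compUV ocf) df dg
    (objs_leNN odf ocf) (objs_leNN ocf ocg) (objs_leNN odf ocg)
    (objs_leNN n_objs n_objs) (objs_leNN n_objs n_objs) (objs_leNN n_objs n_objs).
  have [alQ|nalQ] := boolP (al (dom f) (cod g) Q); [left | right].
    have hz : [/\ dom f \in objs, cod g \in objs, is_diag (dom f) (cod g) Q
      & al (dom f) (cod g) Q] by split.
    exists (delta ^+ dloops (dom f) (cod f) (cod g) (dia f) (dia g))%R, (mk objs_leN hz); split.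
    + apply: (@basis_mul_is _ _ _ _ (dom f) (cod f) (cod g) (dia f) (dia g));
        by rewrite ?mkE ?egf.
    + rewrite -exprD -loopsQ.
      by apply: (@basis_mul_is _ _ _ _ n n n _ _ _ _ _ erefl _ _ erefl);
        rewrite /extb ?mkE ?egf ?extQ.
    + by apply: ob_inj; rewrite !ob_src mkE.
    + by apply: ob_inj; rewrite !ob_tgt mkE.
  split.
    apply: (@basis_mul_zero _ _ _ (dom f) (cod f) (cod g) (dia f) (dia g)); by rewrite ?egf.
  apply: (@basis_mul_zero _ _ _ n n n _ _ _ _ erefl _ _ erefl); rewrite /extb ?mkE //.
  by rewrite egf extQ al_extUV.
- move=> f; have [od oc df af] := basisP f.
  have [extQ loopsQ] := ext_comp (rowV od) (row_id (dom f)) (row_id (dom f)) (row_id (cod f))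
    (compatible_id (dom f)) (idp od) df (objs_leNN od od) (objs_leNN od oc) (objs_leNN od oc)
    (objs_leNN n_objs od) (objs_leNN od oc) (objs_leNN n_objs oc).
  rewrite (ext_ii od oc df) dcomp_id_l ?objs_leNN // in extQ.
  rewrite (ext_ii od oc df) dloops_id_l ?objs_leNN // in loopsQ.
  (* The scalar 1 becomes [delta ^+ 0], and this 0 the number of loops of the gluing at hand. *)
  rewrite -(expr0 delta) -[X in (delta ^+ X)%R]loopsQ.
  by apply: (@basis_mul_is _ _ _ _ n (dom f) (cod f) _ _ _ _ _ erefl _ _ erefl);
    rewrite /v /hextb ?mkE ?ob_src ?extQ.
- move=> f; have [od oc df af] := basisP f.
  have [extQ loopsQ] := ext_comp (rowV od) (row_id (cod f)) (row_id (cod f)) (rowU oc)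
    (compatible_id (cod f)) df (idp oc) (objs_leNN od oc) (objs_leNN oc oc) (objs_leNN od oc)
    (objs_leNN n_objs oc) (objs_leNN oc n_objs) (objs_leNN n_objs n_objs).
  rewrite dcomp_id_r ?objs_leNN // in extQ; rewrite dloops_id_r ?objs_leNN // in loopsQ.
  rewrite -(expr0 delta) -[X in (delta ^+ X)%R]loopsQ.
  by apply: (@basis_mul_is _ _ _ _ n (cod f) n _ _ _ _ _ erefl _ _ erefl);
    rewrite /u /inc /hextb /extb ?mkE ?ob_tgt ?extQ.
- move=> o; have oo := obP o.
  have [extQ loopsQ] := ext_comp (row_id (ob o)) (rowU oo) (rowV oo) (row_id (ob o))
    (compUV oo) (idp oo) (idp oo) (objs_leNN oo oo) (objs_leNN oo oo) (objs_leNN oo oo)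
    (objs_leNN oo n_objs) (objs_leNN n_objs oo) (objs_leNN oo oo).
  rewrite (dcomp_id_r (idp oo)) ?objs_leNN // (ext_ii oo oo (idp oo)) in extQ.
  rewrite (dloops_id_r (idp oo)) ?objs_leNN // in loopsQ.
  rewrite -[X in (delta ^+ X)%R]loopsQ.
  by apply: (@basis_mul_is _ _ _ _ (ob o) n (ob o) _ _ _ _ _ erefl _ _ erefl);
    rewrite /u /v /idx ?mkE ?extQ.
Qed.

End CatMorita.

(** * Extended diagrams in the diagram classes *)

(** [Q] collects what a class of diagrams asks of a single row: nothing for all partitions,
    [planar_row] for Brauer, annular and Temperley-Lieb diagrams, [wall_row] for walled ones. *)
Definition good_rows (K : fieldType) (delta : K) (n : nat) (objs : seq nat)
    (Q : nat -> nat -> (nat -> nat + nat) -> (nat -> nat) -> Prop) : Prop :=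
  exists (U V rho : nat -> nat -> nat + nat) (phi psi : nat -> nat -> nat) (k : nat -> nat),
  [/\ forall m, m \in objs -> row m n (U m) (phi m) /\ row m n (V m) (psi m),
      forall m, m \in objs -> compatible m n (k m) (U m) (V m) (rho m),
      forall m, m \in objs -> Q m n (U m) (phi m) /\ Q m n (V m) (psi m),
      forall m, m \in objs -> (delta ^+ k m != 0)%R &
      [/\ k n = 0, forall y, y < n -> U n y = inl y & forall y, y < n -> V n y = inl y]].

Lemma foldr_maxn_bound (s : seq nat) n :
  n \in s -> (forall m, m \in s -> m <= n) -> foldr maxn 0 s = n.
Proof.
move=> sn len; apply/eqP; rewrite eqn_leq; apply/andP; split.
  elim: s len {sn} => //= m s IHs len; rewrite geq_max len ?mem_head //.
  by apply: IHs => m' sm'; apply: len; rewrite inE sm' orbT.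
elim: s sn {len} => //= m s IHs; rewrite inE leq_max => /predU1P[->|/IHs->].
  by rewrite leqnn.
by rewrite orbT.
Qed.

(** One condition on pairs of rows covers all extensions: an end that is not lengthened uses the
    bare row [inl], [id], for which [Q] is assumed. *)
Lemma cat_alg_morita (K : fieldType) (delta : K) (n : nat) (objs : seq nat)
    (al : forall N, nat -> nat -> {set {set 'I_N}} -> bool)
    (Q : nat -> nat -> (nat -> nat + nat) -> (nat -> nat) -> Prop) :
  n \in objs -> (forall m, m \in objs -> m <= n) ->
  (forall m, m \in objs -> Q m m inl id) ->
  (forall m, m \in objs -> al n.*2 m m (idpart n.*2 m)) ->
  (forall m m' l l' d e phi phi' (P : {set {set 'I_n.*2}}),
     m \in objs -> m' \in objs -> l \in objs -> l' \in objs ->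
     row m l d phi -> row m' l' e phi' -> Q m l d phi -> Q m' l' e phi' ->
     is_diag m m' P -> al _ l l' (ext m l l' d e P) = al _ m m' P) ->
  good_rows delta n objs Q ->
  morita_equiv (cat_alg delta [:: n] al) (cat_alg delta objs al).
Proof.
move=> on len Qid al_id al_ext [U [V [rho [phi [psi [k [rows comp Qs dk [kn Un Vn]]]]]]]].
have E1 : Nof [:: n] = n.*2 by rewrite /Nof (foldr_maxn_bound (n := n)) ?mem_head // => m;
  rewrite inE => /eqP->.
have E2 : Nof objs = n.*2 by rewrite /Nof (foldr_maxn_bound on len).
rewrite -[cat_alg delta [:: n] al]/(cat_algN delta (@al (Nof [:: n])) [:: n]) E1.
rewrite -[cat_alg delta objs al]/(cat_algN delta (@al (Nof objs)) objs) E2.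
have rowU m : m \in objs -> row m n (U m) (phi m) by move/rows=> [].
have rowV m : m \in objs -> row m n (V m) (psi m) by move/rows=> [].
have QU m : m \in objs -> Q m n (U m) (phi m) by move/Qs=> [].
have QV m : m \in objs -> Q m n (V m) (psi m) by move/Qs=> [].
apply: (cat_morita on erefl len rowU rowV comp Un Vn kn dk al_id) =>
    m m' P om om' dP; [|move=> alP|move=> alP].
- exact: (al_ext _ _ _ _ _ _ _ _ _ om om' on on (rowV _ om) (rowU _ om') (QV _ om) (QU _ om') dP).
- by rewrite (al_ext _ _ _ _ _ _ _ _ _ om om' on om'
    (rowV _ om) (row_id m') (QV _ om) (Qid _ om') dP).
- by rewrite (al_ext _ _ _ _ _ _ _ _ _ om om' om on
    (row_id m) (rowU _ om') (Qid _ om) (QU _ om') dP).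
Qed.

(** * Criteria on points, and their behaviour under extension *)

Section Allowed.
Variable N : nat.
Implicit Types P : {set {set 'I_N}}.

Lemma brauerbP M P : partition P (points N M) -> M <= N ->
  reflect (forall x, x < M -> exists y, [/\ blk P x y, y <> x &
             forall z, blk P x z -> z = x \/ z = y]) (brauerb P).
Proof.
move=> partP leMN; apply: (iffP forallP) => [brP x ltx|brP B].
  have ltxN := leq_trans ltx leMN; pose u := Ordinal ltxN.
  have Pu : u \in cover P by rewrite (cover_partition partP) inE.
  have := brP (pblock P u); rewrite pblock_mem //= => /cards2P[a [b [ne_ab defB]]].
  have /orP Bu : (u == a) || (u == b) by rewrite -in_set2 -defB mem_pblock.
  wlog eu : a b ne_ab defB Bu / u = a => [hw|].
    case: Bu => /eqP eu; first by apply: (hw a b) => //; left; apply/eqP.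
    by apply: (hw b a) => //; [rewrite eq_sym | rewrite setUC | left; apply/eqP].
  exists b; split.
  - by rewrite -[x]/(val u) (blk_pblock partP) defB !inE eqxx orbT.
  - by move=> ebx; case/eqP: ne_ab; rewrite -eu; apply: val_inj.
  - move=> z bxz; have [_ ltz] := blk_lt partP bxz.
    have ltzN := leq_trans ltz leMN.
    have : Ordinal ltzN \in pblock P u by rewrite -(blk_pblock partP).
    by rewrite defB !inE => /orP[]/eqP/(congr1 val) /= ->; [left; rewrite -eu | right].
apply/implyP=> PB; have /set0Pn[u Bu] : B != set0.
  by apply: contraTneq PB => ->; have /and3P[] := partP.
have tiP := partition_trivIset partP; have defB := def_pblock tiP PB Bu.
have ltu : u < M.
  have : u \in points N M by rewrite -(cover_partition partP); apply/bigcupP; exists B.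
  by rewrite inE.
have [y [buy ney yz]] := brP _ ltu; have [_ lty] := blk_lt partP buy.
have ltyN := leq_trans lty leMN; pose v := Ordinal ltyN.
apply/cards2P; exists u, v; split.
  by apply/eqP=> euv; apply: ney; rewrite euv.
apply/setP=> w; rewrite -defB -(blk_pblock partP) !inE; apply/idP/orP => [/yz[]ew|].
- by left; apply/eqP/val_inj.
- by right; apply/eqP/val_inj.
- by case=> /eqP-> //; apply: blk_refl partP _ _.
Qed.

Lemma noncrossingP (f : nat -> nat) P :
  reflect (forall x1 y1 x2 y2, blk P x1 y1 -> blk P x2 y2 ->
             f x1 < f x2 -> f x2 < f y1 -> f y1 < f y2 -> False) (noncrossing f P).
Proof.
apply: (iffP forallP) => [ncP x1 y1 x2 y2|ncP B1].
  case/blkP=> u1 [v1 [<- <- [B1 PB1 /andP[Bu1 Bv1]]]].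
  case/blkP=> u2 [v2 [<- <- [B2 PB2 /andP[Bu2 Bv2]]]] f1 f2 f3.
  have := ncP B1; rewrite PB1 => /forallP/(_ B2); rewrite PB2 => /forallP/(_ u1).
  rewrite Bu1 => /forallP/(_ v1); rewrite Bv1 => /forallP/(_ u2).
  by rewrite Bu2 => /forallP/(_ v2); rewrite Bv2 /= f1 f2 f3.
apply/implyP=> PB1; apply/forallP=> B2; apply/implyP=> PB2.
apply/forallP=> u1; apply/implyP=> Bu1; apply/forallP=> v1; apply/implyP=> Bv1.
apply/forallP=> u2; apply/implyP=> Bu2; apply/forallP=> v2; apply/implyP=> Bv2.
apply/negP=> /and3P[]; apply: ncP.
  by apply/blk_val; exists B1 => //; rewrite Bu1.
by apply/blk_val; exists B2 => //; rewrite Bu2.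
Qed.

Lemma wallP (cond : nat -> nat -> bool) P :
  reflect (forall x y, blk P x y -> x <> y -> cond x y)
   [forall B in P, forall x in B, forall y in B, (x != y) ==> cond (x : 'I_N) (y : 'I_N)].
Proof.
apply: (iffP forallP) => [wall x y|wall B].
  case/blkP=> u [v [<- <- [B PB /andP[Bu Bv]]]] neuv; have := wall B.
  rewrite PB => /forallP/(_ u); rewrite Bu => /forallP/(_ v); rewrite Bv /=.
  by move/implyP; apply; apply/eqP=> euv; apply: neuv; rewrite euv.
apply/implyP=> PB; apply/forallP=> u; apply/implyP=> Bu; apply/forallP=> v.
apply/implyP=> Bv; apply/implyP=> neuv; apply: wall.
  by apply/blk_val; exists B; rewrite ?Bu.
by move/val_inj/eqP; rewrite (negbTE neuv).
Qed.

Section ExtAllowed.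
Variables (m m' n n' : nat) (d e : nat -> nat + nat) (phi phi' : nat -> nat).
Variable P : {set {set 'I_N}}.
Hypotheses (row_d : row m n d phi) (row_e : row m' n' e phi').
Hypotheses (partP : partition P (points N (m + m'))).
Hypotheses (leN1 : m + m' <= N) (leN2 : n + n' <= N).

(** The place in the long diagram of a point of the short one; [ext_pt] inverts it on strands. *)
Definition theta x := if x < m then phi x else n + phi' (x - m).
Let E := ext m n n' d e P.

Lemma theta_lt x : x < m + m' -> theta x < n + n'.
Proof.
move=> ltx; rewrite /theta; case: ifP => [ltxm|nltxm].
  by have [/(_ _ ltxm)[] + _ _] := row_d; lia.
have ltx' : x - m < m' by lia.
by have [/(_ _ ltx')[] + _ _] := row_e; lia.
Qed.

Lemma ext_pt_theta x : x < m + m' -> ext_pt n m d e (theta x) = inl x.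
Proof.
move=> ltx; rewrite /theta; case: ifP => [ltxm|nltxm].
  by have [/(_ _ ltxm)[lt_phi d_phi] _] := row_d; rewrite /ext_pt lt_phi d_phi.
have ltx' : x - m < m' by lia.
rewrite /ext_pt ltn_nge_addr addKn.
by have [/(_ _ ltx')[_ ->] _] := row_e; rewrite /= subnKC //; lia.
Qed.

Lemma ext_pt_inl z x : z < n + n' -> ext_pt n m d e z = inl x ->
  x < m + m' /\ z = theta x.
Proof.
move=> ltz; rewrite /ext_pt /theta; case: ifP => [ltzn|nltzn].
  case d_z: (d z) => [x'|//] /= [<-]; rewrite add0n.
  by have [_ /(_ _ _ ltzn d_z)[ltx' ->]] := row_d; rewrite ltx'; split; first lia.
have ltz' : z - n < n' by lia.
case e_z: (e (z - n)) => [x'|//] /= [<-].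
have [_ /(_ _ _ ltz' e_z)[ltx' phi_x]] := row_e.
by rewrite ltn_nge_addr addKn phi_x; split; lia.
Qed.

Lemma blk_ext x y : blk E x y =
  [&& x < n + n', y < n + n' &
      liftc (cls P) (ext_pt n m d e x) == liftc (cls P) (ext_pt n m d e y)].
Proof. exact: blk_class_part. Qed.

Lemma blk_ext_theta x y : x < m + m' -> y < m + m' ->
  blk E (theta x) (theta y) = blk P x y.
Proof.
move=> ltx lty; rewrite blk_ext !theta_lt ?ext_pt_theta //=.
by rewrite -(cls_eq partP).
Qed.

Lemma blk_ext_cases x y : blk E x y ->
  (exists x0 y0, [/\ blk P x0 y0, x = theta x0, y = theta y0, x0 < m + m' & y0 < m + m']) \/
  (exists l, [/\ ext_pt n m d e x = inr l, ext_pt n m d e y = inr l, x < n + n' & y < n + n']).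
Proof.
rewrite blk_ext => /and3P[ltx lty].
case def_x: (ext_pt n m d e x) => [x0|l]; case def_y: (ext_pt n m d e y) => [y0|l'] //=.
  have [[ltx0 ->] [lty0 ->]] := (ext_pt_inl ltx def_x, ext_pt_inl lty def_y).
  by move=> bxy; left; exists x0, y0; rewrite -(cls_eq partP).
by case/eqP=> ->; right; exists l'.
Qed.

Definition pairs_row k (c : nat -> nat + nat) := forall y t, y < k -> c y = inr t ->
  exists y', [/\ y' < k, y' <> y, c y' = inr t & forall z, z < k -> c z = inr t -> z = y \/ z = y'].

Lemma brauerb_ext : pairs_row n d -> pairs_row n' e -> brauerb E = brauerb P.
Proof.
move=> pd pe; have partE : partition E (points N (n + n')) by apply: ext_partition.
apply/(brauerbP partE leN2)/(brauerbP partP leN1) => brP x ltx.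
  have [y [bxy neyx yz]] := brP _ (theta_lt ltx).
  have [|[l []]] := blk_ext_cases bxy; last by rewrite ext_pt_theta.
  case=> x0 [y0 [bxy0 ex ey ltx0 lty0]]; move: (ext_pt_theta ltx).
  rewrite ex ext_pt_theta // => -[ex0]; rewrite {x0}ex0 in bxy0 ex ltx0 *.
  exists y0; split=> // [ey0|z bxz]; first by apply: neyx; rewrite ey ey0.
  have [_ ltz] := blk_lt partP bxz.
  have /yz : blk E (theta x) (theta z) by rewrite blk_ext_theta.
  case=> /(congr1 (ext_pt n m d e)); rewrite ?ey !ext_pt_theta // => -[->]; by [left|right].
case def_x: (ext_pt n m d e x) => [x0|l].
  have [ltx0 ->] := ext_pt_inl ltx def_x.
  have [y0 [bxy0 neyx yz]] := brP _ ltx0; have [_ lty0] := blk_lt partP bxy0.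
  exists (theta y0); rewrite blk_ext_theta //; split=> // [|z].
    by move/(congr1 (ext_pt n m d e)); rewrite !ext_pt_theta // => -[].
  case/blk_ext_cases=> [[x1 [z1 [bxz1 ex -> ltx1 ltz1]]]|[l []]]; last first.
    by rewrite ext_pt_theta.
  move: (ext_pt_theta ltx0); rewrite ex ext_pt_theta // => -[ex1].
  by move: bxz1; rewrite ex1 => /yz[->|->]; [left|right].
have same y : blk E x y -> y < n + n' /\ ext_pt n m d e y = inr l.
  case/blk_ext_cases=> [[x1 [z1 [_ ex _ ltx1 _]]]|[l' [ex -> _ lty]]].
    by move: def_x; rewrite ex ext_pt_theta.
  by move: ex; rewrite def_x => -[->].
have sameI y : y < n + n' -> ext_pt n m d e y = inr l -> blk E x y.
  by move=> lty ey; rewrite blk_ext ltx lty def_x ey /=.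
move: def_x; rewrite /ext_pt; case: ifP => [ltxn|nltxn].
  case d_x: (d x) => [//|t] [el]; have [y [lty ney d_y yz]] := pd _ _ ltxn d_x.
  exists y; split=> //; first by apply: sameI; rewrite /ext_pt ?lty ?d_y -?el //; lia.
  move=> z /same[ltz]; rewrite /ext_pt -el; case: ifP => [ltzn|_]; last by case: (e _).
  by case d_z: (d z) => [//|t'] [et]; apply: yz => //; rewrite d_z et.
have ltx' : x - n < n' by lia.
case e_x: (e (x - n)) => [//|t] [el]; have [y [lty ney e_y yz]] := pe _ _ ltx' e_x.
exists (n + y); split; last 1 first.
- move=> z /same[ltz]; rewrite /ext_pt -el; case: ifP => [ltzn|nltzn]; first by case: (d _).
  case e_z: (e (z - n)) => [//|t'] [et]; have ltz' : z - n < n' by lia.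
  by case: (yz _ ltz'); [rewrite e_z et | left; lia | right; lia].
- apply: sameI; rewrite ?ltn_add2l // /ext_pt ltn_nge_addr addKn e_y.
  by rewrite -el.
by move=> exy; apply: ney; lia.
Qed.

Section ExtNoncrossing.
Variables (f f0 : nat -> nat).
Hypothesis f_mono : forall x y, x < m + m' -> y < m + m' ->
  (f (theta x) < f (theta y)) = (f0 x < f0 y).

Lemma noncrossing_ext_inv : noncrossing f E -> noncrossing f0 P.
Proof.
move/noncrossingP=> ncE; apply/noncrossingP=> x1 y1 x2 y2 b1 b2.
have [[ltx1 lty1] [ltx2 lty2]] := (blk_lt partP b1, blk_lt partP b2).
by rewrite -!f_mono //; apply: ncE; rewrite blk_ext_theta.
Qed.

(** Two points of an extra block are at most consecutive for [f], so nothing lies strictly between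
    them; crossings of the other blocks are crossings in [P]. *)
Lemma noncrossing_ext :
  (forall z z' l, z < n + n' -> z' < n + n' -> ext_pt n m d e z = inr l ->
     ext_pt n m d e z' = inr l -> f z < f z' -> f z' <= (f z).+1) ->
  noncrossing f0 P -> noncrossing f E.
Proof.
move=> adj /noncrossingP ncP; apply/noncrossingP=> x1 y1 x2 y2 b1 b2 f1 f2 f3.
case/blk_ext_cases: b1 => [[u1 [v1 [b1 eu1 ev1 ltu1 ltv1]]]|[l [eu ev ltu ltv]]]; last first.
  by have := adj _ _ _ ltu ltv eu ev; lia.
case/blk_ext_cases: b2 => [[u2 [v2 [b2 eu2 ev2 ltu2 ltv2]]]|[l [eu ev ltu ltv]]]; last first.
  by have := adj _ _ _ ltu ltv eu ev; lia.
by apply: (ncP _ _ _ _ b1 b2); rewrite -f_mono // -?eu1 -?ev1 -?eu2 -?ev2.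
Qed.

End ExtNoncrossing.

Lemma walledb_ext p : pairs_row n d -> pairs_row n' e ->
  (forall x, x < m -> (phi x < p + (n - p)./2) = (x < p + (m - p)./2)) ->
  (forall x, x < m' -> (phi' x < p + (n' - p)./2) = (x < p + (m' - p)./2)) ->
  (forall y y' t, y < n -> y' < n -> y <> y' -> d y = inr t -> d y' = inr t ->
     (y < p + (n - p)./2) != (y' < p + (n - p)./2)) ->
  (forall y y' t, y < n' -> y' < n' -> y <> y' -> e y = inr t -> e y' = inr t ->
     (y < p + (n' - p)./2) != (y' < p + (n' - p)./2)) ->
  walledb p n n' E = walledb p m m' P.
Proof.
move=> pd pe hd he wd we; rewrite /walledb brauerb_ext //; congr andb.
pose left a b x := if x < a then x < p + (a - p)./2 else x - a < p + (b - p)./2.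
pose cond a b x y := if (x < a) == (y < a) then left a b x != left a b y
                     else left a b x == left a b y.
have theta_ltn x : x < m + m' -> (theta x < n) = (x < m).
  rewrite /theta; case: ifP => ltx _; last by rewrite ltn_nge_addr.
  by have [/(_ _ ltx)[]] := row_d.
have theta_left x : x < m + m' -> left n n' (theta x) = left m m' x.
  move=> ltx; rewrite /left theta_ltn // /theta; case ltxm: (x < m) => /=; first exact: hd.
  by rewrite addKn he //; lia.
have theta_cond x y : x < m + m' -> y < m + m' ->
    cond n n' (theta x) (theta y) = cond m m' x y.
  by move=> ltx lty; rewrite /cond !theta_ltn // !theta_left.
apply/(wallP (cond n n'))/(wallP (cond m m')) => wall x y bxy nexy.
  have [ltx lty] := blk_lt partP bxy; rewrite -theta_cond //.
  apply: wall; first by rewrite blk_ext_theta.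
  by move/(congr1 (ext_pt n m d e)); rewrite !ext_pt_theta // => -[].
case/blk_ext_cases: bxy => [[x0 [y0 [bxy ex ey ltx0 lty0]]]|[l [ex ey ltx lty]]].
  by rewrite ex ey theta_cond //; apply: wall => // exy; apply: nexy; rewrite ex ey exy.
move: ex ey; rewrite /ext_pt /cond /left.
case: (ltnP x n) => ltxn; case: (ltnP y n) => ltyn /=.
- case d_x: (d x) => [//|t] [<-]; case d_y: (d y) => [//|t'] [et].
  by rewrite et in d_y; apply: wd d_x d_y.
- by case: (d x) => // t [<-]; case: (e _).
- by case: (e _) => // t [<-]; case: (d _).
case d_x: (e (x - n)) => [//|t] [<-]; case d_y: (e (y - n)) => [//|t'] [et].
by rewrite et in d_y; apply: we d_x d_y; lia.
Qed.

(* Position, on the boundary circle cut open after rotating the rows by [r] and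
   [s], of the points of the two rows. *)
Definition jpos (a b r s x : nat) := pos a b (Defs.rot a b r s x).
Definition cut_pos (k r x : nat) := (x + r) %% k.

Lemma jpos_bot a b r s x : x < a -> jpos a b r s x = cut_pos a r x.
Proof.
move=> ltx; rewrite /jpos /Defs.rot ltx /pos /cut_pos ltn_mod.
by have -> : 0 < a by lia.
Qed.

Lemma jpos_top a b r s x :
  jpos a b r s (a + x) = a + (b.-1 - cut_pos b s x).
Proof. by rewrite /jpos /Defs.rot ltn_nge_addr /pos ltn_nge_addr !addKn. Qed.

Definition cut_mono k l (psi : nat -> nat) r0 r := forall x y, x < k -> y < k ->
  (cut_pos l r (psi x) < cut_pos l r (psi y)) = (cut_pos k r0 x < cut_pos k r0 y).

Definition cut_adj l (c : nat -> nat + nat) r := forall y y' t, y < l -> y' < l ->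
  c y = inr t -> c y' = inr t -> cut_pos l r y < cut_pos l r y' ->
  cut_pos l r y' <= (cut_pos l r y).+1.

Section Rotation.
Variables (r0 r s0 s : nat).
Hypotheses (mono_d : cut_mono m n phi r0 r) (mono_e : cut_mono m' n' phi' s0 s).

Lemma cut_pos_lt k t x : x < k -> cut_pos k t x < k.
Proof. by move=> ltx; rewrite ltn_mod; lia. Qed.

(** Bottom points precede top points in both diagrams, so only the order within a row matters. The
    top row is traversed backwards, which is why [mono_e] is used with its arguments exchanged. *)
Lemma jpos_theta x y : x < m + m' -> y < m + m' ->
  (jpos n n' r s (theta x) < jpos n n' r s (theta y)) =
  (jpos m m' r0 s0 x < jpos m m' r0 s0 y).
Proof.
have top z : z < m + m' -> m <= z -> exists2 w, w < m' & z = m + w.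
  by move=> ltz lez; exists (z - m); lia.
have lt_phi w : w < m -> phi w < n by move=> ltw; have [/(_ _ ltw)[]] := row_d.
have lt_phi' w : w < m' -> phi' w < n' by move=> ltw; have [/(_ _ ltw)[]] := row_e.
move=> ltx lty; rewrite /theta; case: (ltnP x m) => [ltxm|/(top x ltx)[x' ltx' ->]];
  case: (ltnP y m) => [ltym|/(top y lty)[y' lty' ->]].
- by rewrite !jpos_bot ?lt_phi // mono_d.
- rewrite addKn !jpos_top !jpos_bot ?lt_phi //.
  by have := cut_pos_lt r0 ltxm; have := cut_pos_lt r (lt_phi _ ltxm); lia.
- rewrite addKn !jpos_top !jpos_bot ?lt_phi //.
  by have := cut_pos_lt r0 ltym; have := cut_pos_lt r (lt_phi _ ltym); lia.
rewrite !addKn !jpos_top !ltn_add2l.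
have := mono_e lty' ltx'; have := cut_pos_lt s0 ltx'; have := cut_pos_lt s0 lty'.
have := cut_pos_lt s (lt_phi' _ ltx'); have := cut_pos_lt s (lt_phi' _ lty'); lia.
Qed.

Lemma jones_noncrossing_ext_inv :
  noncrossing (jpos n n' r s) E -> noncrossing (jpos m m' r0 s0) P.
Proof. exact: noncrossing_ext_inv jpos_theta. Qed.

Lemma jones_noncrossing_ext : cut_adj n d r -> cut_adj n' e s ->
  noncrossing (jpos m m' r0 s0) P -> noncrossing (jpos n n' r s) E.
Proof.
move=> ad ae; apply: noncrossing_ext jpos_theta _ => z z' l ltz ltz'; rewrite /ext_pt.
case: (ltnP z n) => lez; case: (ltnP z' n) => lez'.
- case d_z: (d z) => [//|t] [<-]; case d_z': (d z') => [//|t'] [et].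
  by rewrite !jpos_bot //; rewrite et in d_z'; apply: ad d_z d_z'.
- by case: (d _) => // t [<-]; case: (e _).
- by case: (e _) => // t [<-]; case: (d _).
have [w ew] : exists w, z = n + w by exists (z - n); lia.
have [w' ew'] : exists w, z' = n + w by exists (z' - n); lia.
rewrite {z}ew {z'}ew' !ltn_add2l in ltz ltz' lez lez' *; rewrite !addKn !jpos_top.
case d_w: (e w) => [//|t] [<-]; case d_w': (e w') => [//|t'] [et]; rewrite et in d_w'.
have := ae _ _ _ ltz' ltz d_w' d_w.
have := cut_pos_lt s ltz; have := cut_pos_lt s ltz'; lia.
Qed.

End Rotation.
End ExtAllowed.

Lemma eq_noncrossing M (f g : nat -> nat) P : partition P (points N M) ->
  (forall x, x < M -> f x = g x) -> noncrossing f P = noncrossing g P.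
Proof.
move=> partP efg; apply/noncrossingP/noncrossingP => ncP x1 y1 x2 y2 b1 b2;
  have [[ltx1 lty1] [ltx2 lty2]] := (blk_lt partP b1, blk_lt partP b2);
  have := ncP _ _ _ _ b1 b2; rewrite !efg //.
Qed.

(** Planarity in the rectangle is planarity for the unrotated cut of the annulus, so both classes
    share the lemmas on [jpos]. *)
Lemma tlbE a b P : partition P (points N (a + b)) ->
  tlb a b P = brauerb P && noncrossing (jpos a b 0 0) P.
Proof.
move=> partP; rewrite /tlb (@eq_noncrossing _ _ (jpos a b 0 0) _ partP) // => x ltx.
rewrite /jpos /Defs.rot; case: ifP => ltxa; first by rewrite addn0 modn_small.
by rewrite addn0 modn_small; [congr pos; lia | lia].
Qed.

(* Cutting an annulus (a row closed up to a circle) at an arbitrary place does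
   not separate the points of an extra block, and every cut of the long row
   induces a cut of the short one. *)
Definition planar_row (m n : nat) (d : nat -> nat + nat) (phi : nat -> nat) : Prop :=
  [/\ pairs_row n d,
      cut_mono m n phi 0 0 /\ cut_adj n d 0,
      forall r0, exists r, [/\ r <= n, cut_mono m n phi r0 r & cut_adj n d r] &
      forall r, exists2 r0, r0 <= m & cut_mono m n phi r0 r].

Lemma planar_row_id m : planar_row m m inl id.
Proof.
have cutm r : exists2 r', r' <= m & cut_mono m m id r r'.
  case: m => [|m]; first by exists 0.
  exists (r %% m.+1); first by rewrite ltnW // ltn_mod.
  by move=> x y _ _; rewrite /cut_pos !modnDmr.
split=> // r; first by have [r' ler' mono] := cutm r; exists r'.
have [r' ler' mono] := cutm r; exists r' => // x y ltx lty.
by rewrite mono.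
Qed.

End Allowed.

Section PlanarAllowed.
Variable N : nat.
Implicit Types P : {set {set 'I_N}}.

Lemma brauer_ext_planar m m' n n' d e phi phi' P :
  row m n d phi -> row m' n' e phi' -> planar_row m n d phi -> planar_row m' n' e phi' ->
  partition P (points N (m + m')) -> m + m' <= N -> n + n' <= N ->
  brauerb (ext m n n' d e P) = brauerb P.
Proof.
by move=> rd re [pd _ _ _] [pe _ _ _] partP le1 le2; apply: (brauerb_ext rd re).
Qed.

Lemma tlb_ext m m' n n' d e phi phi' P :
  row m n d phi -> row m' n' e phi' -> planar_row m n d phi -> planar_row m' n' e phi' ->
  partition P (points N (m + m')) -> m + m' <= N -> n + n' <= N ->
  tlb n n' (ext m n n' d e P) = tlb m m' P.
Proof.
move=> rd re pd pe partP le1 le2; rewrite (tlbE partP) (tlbE (ext_partition _ _ _ _ _ _)).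
apply: (f_equal2 andb (brauer_ext_planar rd re pd pe partP le1 le2)).
case: pd pe => [_ [md ad] _ _] [_ [me ae] _ _]; apply/idP/idP.
  exact: (jones_noncrossing_ext_inv rd re partP le1 le2 md me).
exact: (jones_noncrossing_ext rd re partP le1 le2 md me ad ae).
Qed.

(** Cuts of the long diagram restrict by the last clause of [planar_row], cuts of the short one
    extend by the third; the two circles are treated independently. *)
Lemma jonesb_ext m m' n n' d e phi phi' P :
  row m n d phi -> row m' n' e phi' -> planar_row m n d phi -> planar_row m' n' e phi' ->
  partition P (points N (m + m')) -> m + m' <= N -> n + n' <= N ->
  jonesb n n' (ext m n n' d e P) = jonesb m m' P.
Proof.
move=> rd re pd pe partP le1 le2; rewrite /jonesb.
apply: (f_equal2 andb (brauer_ext_planar rd re pd pe partP le1 le2)).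
case: pd pe => [_ _ up_d down_d] [_ _ up_e down_e]; apply/existsP/existsP.
  case=> r /existsP[s ncE]; have [r0 ler0 md] := down_d r; have [s0 les0 me] := down_e s.
  (* The bounds in [planar_row] serve here: [jonesb] only allows rotations below [N.+1]. *)
  have [ltr0 lts0] : r0 < N.+1 /\ s0 < N.+1 by lia.
  exists (Ordinal ltr0); apply/existsP; exists (Ordinal lts0).
  exact: (jones_noncrossing_ext_inv rd re partP le1 le2 md me ncE).
case=> r0 /existsP[s0 ncP]; have [r [ler md ad]] := up_d r0; have [s [les me ae]] := up_e s0.
have [ltr lts] : r < N.+1 /\ s < N.+1 by lia.
exists (Ordinal ltr); apply/existsP; exists (Ordinal lts).
exact: (jones_noncrossing_ext rd re partP le1 le2 md me ad ae ncP).
Qed.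

Section IdentityAllowed.
Variable a : nat.
Hypothesis leN : a + a <= N.

Lemma brauerb_idpart : brauerb (idpart N a).
Proof.
apply/(brauerbP (idpart_partition leN) leN) => x ltx.
exists (if x < a then x + a else x - a); rewrite !blk_idpart // /fold_row.
split.
- by case: ifP => ltxa; case: ifP; lia.
- by case: ifP; lia.
move=> z; rewrite blk_idpart // /fold_row; case: ifP => ltxa; case: ifP => ltza; lia.
Qed.

Lemma tlb_idpart : tlb a a (idpart N a).
Proof.
rewrite /tlb brauerb_idpart /=; apply/noncrossingP => x1 y1 x2 y2.
rewrite !blk_idpart // /fold_row /pos => /and3P[ltx1 lty1 e1] /and3P[ltx2 lty2 e2].
move: e1 e2; case: (ltnP x1 a) => ?; case: (ltnP y1 a) => ?;
  case: (ltnP x2 a) => ?; case: (ltnP y2 a) => ?; lia.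
Qed.

Lemma jonesb_idpart : jonesb a a (idpart N a).
Proof.
have := tlb_idpart; rewrite (tlbE (idpart_partition leN)) => /andP[br nc].
by rewrite /jonesb br; apply/existsP; exists ord0; apply/existsP; exists ord0.
Qed.

Lemma walledb_idpart p : walledb p a a (idpart N a).
Proof.
rewrite /walledb brauerb_idpart /=.
apply/(wallP (fun x y => if (x < a) == (y < a) then
    (if x < a then x < p + (a - p)./2 else x - a < p + (a - p)./2) !=
    (if y < a then y < p + (a - p)./2 else y - a < p + (a - p)./2)
  else (if x < a then x < p + (a - p)./2 else x - a < p + (a - p)./2) ==
    (if y < a then y < p + (a - p)./2 else y - a < p + (a - p)./2))).
move=> x y; rewrite blk_idpart // /fold_row => /and3P[ltx lty].
by case: (ltnP x a) => ?; case: (ltnP y a) => ? /= /eqP e nexy; (lia || by rewrite e eqxx).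
Qed.

End IdentityAllowed.
End PlanarAllowed.

(** * The rows of cups and caps *)

Lemma cut_posE k r x : x < k ->
  cut_pos k r x = if x + r %% k < k then x + r %% k else x + r %% k - k.
Proof.
move=> ltx; rewrite /cut_pos -modnDmr; have ltr : r %% k < k by rewrite ltn_mod; lia.
case: ltnP => [ltk|lek]; first by rewrite modn_small.
by rewrite -{1}(subnK lek) modnDr modn_small //; lia.
Qed.

Lemma cut_pos0 k x : x < k -> cut_pos k 0 x = x.
Proof. by move=> ltx; rewrite /cut_pos addn0 modn_small. Qed.

(** When a row is glued to its mirror image each extra block meets itself: the components are the
    labels of the row, and each of the [k] labels is a loop. *)
Lemma compatible_diag m n k d phi : row m n d phi ->
  (forall t, (exists2 y, y < n & d y = inr t) <-> t < k) -> compatible m n k d d d.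
Proof.
case=> row1 row2 labels; split.
- by move=> y y' _ _ [].
- by move=> y x _ [].
- by move=> y x lty /row2[].
- by move=> T c cd _ y y' lty lty'; apply: cd.
- exact: labels.
Qed.

(** * Rows for Brauer, annular and Temperley-Lieb diagrams *)

Section ParityRows.
Variables (m h : nat).
Let n := m + h.*2.

Definition tail_row (y : nat) : nat + nat :=
  if y < m then inl y else inr (y - m)./2.

(* The last strand moved to the end of the row: glued to [tail_row], it
   straightens a zigzag without closing a loop. *)
Definition zigzag_row (y : nat) : nat + nat :=
  if y < m.-1 then inl y else if y == n.-1 then inl m.-1 else inr (y - m.-1)./2.
Definition zigzag_emb (x : nat) : nat := if x < m.-1 then x else n.-1.
Definition zigzag_comp (y : nat) : nat + nat := inl (if y < m.-1 then y else m.-1).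

Lemma row_tail : row m n tail_row id.
Proof.
split=> [x ltx|y x lty]; first by rewrite /tail_row ltx /n; split => //; lia.
by rewrite /tail_row; case: ifP => // ltym [<-].
Qed.

Lemma tail_row_pairs : pairs_row n tail_row.
Proof.
move=> y t lty; rewrite /tail_row; case: ltnP => // lemy [et].
exists (if odd (y - m) then y.-1 else y.+1).
split.
- by rewrite /n in lty *; case: ifP; lia.
- by case: ifP; lia.
- by case oy: (odd (y - m)); (case: ifP => [?|_]; [exfalso; lia | congr inr; lia]).
by move=> z ltz; case: ltnP => // lemz [et']; case: ifP; lia.
Qed.

Lemma tail_row_labels t : (exists2 y, y < n & tail_row y = inr t) <-> t < h.
Proof.
split=> [[y lty]|lth]; first by rewrite /tail_row /n in lty *; case: ltnP => // lemy [<-]; lia.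
exists (m + t.*2); first by rewrite /n; lia.
by rewrite /tail_row ltn_nge_addr addKn doubleK.
Qed.

Lemma planar_tail_row : planar_row m n tail_row id.
Proof.
split; first exact: tail_row_pairs.
- split=> [x y ltx lty|y y' t lty lty'].
    by rewrite !cut_pos0 //= /n; lia.
  rewrite /tail_row; case: ltnP => // lemy [et]; case: ltnP => // lemy' [et'].
  by rewrite !cut_pos0 //; lia.
- move=> r0; case: (posnP m) => [m0|m_gt0].
    exists 0; split=> // [x y|y y' t lty lty']; first by rewrite m0.
    rewrite /tail_row; case: ltnP => // lemy [et]; case: ltnP => // lemy' [et'].
    by rewrite !cut_pos0 //; lia.
  have ltq : r0 %% m < m by rewrite ltn_mod.
  (* A nonzero rotation by [r] makes [n - r] the first point. Both rows are thus cut before the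
     strand [m - r0 %% m], or before strand 0 when [m] divides [r0], never inside a cup. *)
  exists (if r0 %% m == 0 then 0 else n - m + r0 %% m); split.
  + by case: ifP; rewrite /n; lia.
  + move=> x y ltx lty; rewrite !cut_posE //= /n; try lia.
    case: eqP => [->|nq]; first by rewrite mod0n; do ?[case: ifP => ?]; lia.
    by rewrite modn_small; [do ?[case: ifP => ?]; lia | lia].
  + move=> y y' t lty lty'.
    rewrite /tail_row; case: ltnP => // lemy [et]; case: ltnP => // lemy' [et'].
    rewrite !cut_posE //.
    case: eqP => [?|nq]; first by rewrite mod0n; do ?[case: ifP => ?]; lia.
    rewrite modn_small; rewrite /n in lty lty' *; last by lia.
    by do ?[case: ifP => ?]; lia.
- move=> r; case: (posnP m) => [m0|m_gt0]; first by exists 0 => // x y; rewrite m0.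
  have n_gt0 : 0 < n by rewrite /n; lia.
  have ltq : r %% n < n by rewrite ltn_mod.
  (* A cut within the tail of cups separates no strands and induces the rotation 0; any other one is
     a cut before the strand [n - r %% n]. *)
  exists (if (r %% n == 0) || (n - r %% n >= m) then 0 else m - (n - r %% n)).
    by case: ifP; lia.
  move=> x y ltx lty; rewrite !cut_posE //= /n; try lia.
  rewrite -/n; set q := r %% n in ltq *.
  case hq: ((q == 0) || (m <= n - q)); rewrite /n in ltq hq *.
    by rewrite mod0n; do ?[case: ifP => ?]; lia.
  by rewrite [_ %% m]modn_small; [do ?[case: ifP => ?]; lia | lia].
Qed.

Section Zigzag.
Hypothesis m_gt0 : 0 < m.

Lemma row_zigzag : row m n zigzag_row zigzag_emb.
Proof.
split=> [x ltx|y x lty].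
  rewrite /zigzag_row /zigzag_emb /n; case: (ltnP x m.-1) => ltxm.
    by rewrite ltxm; split=> //; lia.
  rewrite eqxx; have -> : ((m + h.*2).-1 < m.-1) = false by lia.
  by split; [|congr inl]; lia.
rewrite /zigzag_row /zigzag_emb; case: ltnP => [ltym [<-]|leym]; first by rewrite ltym; split; lia.
by case: eqP => // ey [<-]; rewrite ltnn; split; lia.
Qed.

Lemma zigzag_row_pairs : pairs_row n zigzag_row.
Proof.
move=> y t lty; rewrite /zigzag_row; case: ltnP => // lemy; case: eqP => // ney [et].
exists (if odd (y - m.-1) then y.-1 else y.+1); rewrite /n in lty ney *.
split.
- by case: ifP; lia.
- by case: ifP; lia.
- case oy: (odd (y - m.-1)); (case: ifP => [?|_]; first by exfalso; lia);
    by (case: eqP => [?|_]; [exfalso; lia | congr inr; lia]).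
by move=> z ltz; case: ltnP => // lemz; case: eqP => // nez [et']; case: ifP; lia.
Qed.

Lemma planar_zigzag_row : planar_row m n zigzag_row zigzag_emb.
Proof.
have lt_emb x : x < m -> zigzag_emb x < n by case: row_zigzag => row1 _ /row1[].
split; first exact: zigzag_row_pairs.
- split=> [x y ltx lty|y y' t lty lty'].
    by rewrite !cut_pos0 ?lt_emb // /zigzag_emb /n; do ?[case: ifP => ?]; lia.
  rewrite /zigzag_row; case: ltnP => // lemy; case: eqP => // ney [et].
  by case: ltnP => // lemy'; case: eqP => // ney' [et']; rewrite !cut_pos0 //; lia.
- move=> r0; have ltq : r0 %% m < m by rewrite ltn_mod.
  (* The same cut as for [tail_row]. For [r0 %% m = 1] it falls before the first cup, and the
     displaced last strand is still the first strand met. *)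
  exists (if r0 %% m == 0 then 0 else n - m + r0 %% m); split.
  + by case: ifP; rewrite /n; lia.
  + move=> x y ltx lty; rewrite !cut_posE ?lt_emb //; set q := r0 %% m in ltq *.
    rewrite /zigzag_emb /n; have [->|nq] := eqVneq q 0.
      by rewrite mod0n; case: (ltnP x m.-1) => ?; case: (ltnP y m.-1) => ?;
      do ?[case: ifP => ?]; lia.
    rewrite modn_small; last by lia.
    by case: (ltnP x m.-1) => ?; case: (ltnP y m.-1) => ?;
      do ?[case: ifP => ?]; lia.
  + move=> y y' t lty lty'; rewrite !cut_posE //; set q := r0 %% m in ltq *.
    rewrite /zigzag_row; case: ltnP => // lemy; case: eqP => // ney [et].
    case: ltnP => // lemy'; case: eqP => // ney' [et'].
    rewrite /n in lty lty' ney ney' *; have [_|nq] := eqVneq q 0.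
      by rewrite mod0n; do ?[case: ifP => ?]; lia.
    by rewrite modn_small; [do ?[case: ifP => ?]; lia | lia].
move=> r; have n_gt0 : 0 < n by rewrite /n; lia.
have ltq : r %% n < n by rewrite ltn_mod.
(* After a cut at a point [n - r %% n >= m] the first strand met is the displaced one at [n.-1],
   whence the rotation 1 of the short row. *)
exists (if r %% n == 0 then 0 else if n - r %% n < m then m - (n - r %% n) else 1).
  by case: ifP => ?; [|case: ifP => ?]; lia.
move=> x y ltx lty; rewrite !cut_posE ?lt_emb //; set q := r %% n in ltq *.
rewrite /zigzag_emb; have [->|nq] := eqVneq q 0.
  by rewrite mod0n /n; case: (ltnP x m.-1) => ?; case: (ltnP y m.-1) => ?;
      do ?[case: ifP => ?]; lia.
case: (ltnP (n - q) m) => hq; rewrite /n in ltq hq *.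
  rewrite [_ %% m]modn_small; last by lia.
  by case: (ltnP x m.-1) => ?; case: (ltnP y m.-1) => ?;
      do ?[case: ifP => ?]; lia.
(* A single strand leaves nothing to order; it is treated apart because [1 %% m] is then 0. *)
have [m1|m_gt1] : m = 1 \/ 1 < m by lia.
  have [-> ->] : x = 0 /\ y = 0 by lia.
  by rewrite !ltnn.
rewrite [1 %% m]modn_small; last by lia.
by case: (ltnP x m.-1) => ?; case: (ltnP y m.-1) => ?;
      do ?[case: ifP => ?]; lia.
Qed.

(** On the points from [m.-1] to [n.-1] the cups of the two rows alternate and form one path. Its
    ends carry the last strand, one in each row, and no loop is closed. *)
Lemma compatible_zigzag : compatible m n 0 tail_row zigzag_row zigzag_comp.
Proof.
split.
- move=> y y' lty lty'; rewrite /tail_row /zigzag_row /zigzag_comp => -[].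
    by do 2 (case: ltnP => ? //); move=> [e]; congr inl; do ?[case: ifP => ?]; lia.
  case: ltnP => ?; case: (ltnP y') => ?; do ?[case: eqP => ? //]; move=> [e]; congr inl; lia.
- move=> y x lty; rewrite /tail_row /zigzag_row /zigzag_comp => -[].
    by case: ltnP => // ? [<-]; congr inl; case: ifP => ?; lia.
  by case: ltnP => [? [<-] //|?]; case: eqP => // ? [<-].
- by move=> y x lty [<-]; case: ifP; lia.
- move=> T c c_tail c_zig.
  have c_const j : m.-1 + j < n -> c (m.-1 + j) = c m.-1.
    elim: j => [|j IHj] ltj; first by rewrite addn0.
    rewrite -IHj; last by lia.
    (* The step from an odd [j] to its successor is a cup of [tail_row], that from an even [j] a cup
       of [zigzag_row]. *)
    case oj: (odd j).
      apply: c_tail; try lia; rewrite /tail_row.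
      case: ifP => [?|_]; first by exfalso; lia.
      by case: ifP => [?|_]; [exfalso; lia | congr inr; lia].
    apply: c_zig; try lia; rewrite /zigzag_row /n in ltj *.
    case: ifP => [?|_]; first by exfalso; lia.
    case: eqP => [?|_]; first by exfalso; lia.
    case: ifP => [?|_]; first by exfalso; lia.
    by case: eqP => [?|_]; [exfalso; lia | congr inr; lia].
  move=> y y' lty lty' [].
  case: (ltnP y m.-1) => ley; case: (ltnP y' m.-1) => ley' e; try lia; first by rewrite e.
  by rewrite -(subnKC ley) -(subnKC ley') !c_const // subnKC.
by move=> t; split=> // -[].
Qed.

End Zigzag.
End ParityRows.

Lemma good_rows_par (K : fieldType) (delta : K) (n : nat) :
  (delta != 0)%R || odd n -> good_rows delta n (objs_par n) planar_row.
Proof.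
have par m : m \in objs_par n -> exists h, n = m + h.*2.
  by case/mapP=> i; rewrite mem_iota => lei ->; exists i; lia.
case/orP=> [d_neq0|odd_n].
  exists tail_row, tail_row, tail_row, (fun _ => id), (fun _ => id), (fun m => (n - m)./2).
  split.
  - by move=> m /par[h ->]; split; apply: row_tail.
  - move=> m /par[h ->]; have -> : (m + h.*2 - m)./2 = h by lia.
    exact: compatible_diag (row_tail m h) (tail_row_labels m h).
  - by move=> m /par[h ->]; split; apply: planar_tail_row.
  - by move=> m _; rewrite expf_neq0.
  - by rewrite subnn; split=> // y lty; rewrite /tail_row lty.
exists tail_row, (fun m => zigzag_row m (n - m)./2), zigzag_comp,
  (fun _ => id), (fun m => zigzag_emb m (n - m)./2), (fun=> 0).
have half m h : (m + h.*2 - m)./2 = h by lia.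
(* All objects have the parity of [n], so for [n] odd each has a strand for the zigzag. *)
have gt0 m h : n = m + h.*2 -> 0 < m by lia.
split.
- by move=> m /par[h en]; rewrite {1 2 3 4}en half; split;
    [apply: row_tail | apply: row_zigzag; apply: gt0 en].
- by move=> m /par[h en]; rewrite {1 2}en half; apply: compatible_zigzag; apply: gt0 en.
- by move=> m /par[h en]; rewrite {1 2 3 4}en half; split;
    [apply: planar_tail_row | apply: planar_zigzag_row; apply: gt0 en].
- by move=> m _; rewrite expr0 oner_neq0.
split=> // y lty; first by rewrite /tail_row lty.
rewrite /zigzag_row; case: ifP => // ley; case: eqP => [?|]; last by lia.
by congr inl; lia.
Qed.

(** The [n - m] added points are singletons, and two facing singletons make one loop. *)
Lemma good_rows_le (K : fieldType) (delta : K) (n : nat) :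
  (delta != 0)%R -> good_rows delta n (objs_le n) (fun _ _ _ _ => True).
Proof.
move=> d_neq0; pose d m y : nat + nat := if y < m then inl y else inr (y - m).
have row_dm m : m <= n -> row m n (d m) id.
  move=> len; split=> [x ltx|y x lty]; first by rewrite /d ltx; split=> //; lia.
  by rewrite /d; case: ifP => // ltym [<-].
have len m : m \in objs_le n -> m <= n by rewrite mem_iota; lia.
exists d, d, d, (fun _ => id), (fun _ => id), (fun m => n - m); split=> //.
- by move=> m /len lem; split; apply: row_dm.
- move=> m /len lem; apply: compatible_diag (row_dm _ lem) _ => t.
  split=> [[y lty]|ltt]; first by rewrite /d; case: ltnP => // ? [<-]; lia.
  by exists (m + t); [lia | rewrite /d ltn_nge_addr addKn].
- by move=> m _; rewrite expf_neq0.
by rewrite subnn; split=> // y lty; rewrite /d lty.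
Qed.

(** * Rows for walled diagrams *)

Definition wall_row (p m n : nat) (d : nat -> nat + nat) (phi : nat -> nat) : Prop :=
  [/\ pairs_row n d,
      forall x, x < m -> (phi x < p + (n - p)./2) = (x < p + (m - p)./2) &
      forall y y' t, y < n -> y' < n -> y <> y' -> d y = inr t -> d y' = inr t ->
        (y < p + (n - p)./2) != (y' < p + (n - p)./2)].

Lemma wall_row_id p m : wall_row p m m inl id.
Proof. by split. Qed.

Section WalledRows.
(* [a] strands left and [i] strands right of the wall, [h] arcs across it. *)
Variables (a h : nat).

(** The arcs are parallel, from [a + t] to [a + h + t], so that moving all left ends by one place
    produces a single path; crossings are harmless, the walled class having no planarity
    condition. *)
Definition nested_row (y : nat) : nat + nat :=
  if y < a then inl y else if y < a + h then inr (y - a) else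
  if y < a + h + h then inr (y - (a + h)) else inl (y - h.*2).
Definition nested_emb (x : nat) : nat := if x < a then x else x + h.*2.

(** All left ends move one place to the left, past the last left strand, which lands next to the
    wall. *)
Definition shifted_row (y : nat) : nat + nat :=
  if y < a.-1 then inl y else if y < (a + h).-1 then inr (y - a.-1) else
  if y == (a + h).-1 then inl a.-1 else
  if y < a + h + h then inr (y - (a + h)) else inl (y - h.*2).
Definition shifted_emb (x : nat) : nat :=
  if x < a.-1 then x else if x == a.-1 then (a + h).-1 else x + h.*2.
Definition shifted_comp (y : nat) : nat + nat :=
  inl (if y < a.-1 then y else if y < a + h + h then a.-1 else y - h.*2).

Lemma nested_rowP z :
  [\/ z < a /\ nested_row z = inl z, a <= z < a + h /\ nested_row z = inr (z - a),
      a + h <= z < a + h + h /\ nested_row z = inr (z - (a + h)) |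
      a + h + h <= z /\ nested_row z = inl (z - h.*2)].
Proof.
rewrite /nested_row; case: ltnP => ?; first by constructor 1.
case: ltnP => ?; first by constructor 2; split=> //; lia.
by case: ltnP => ?; [constructor 3; split=> //; lia | constructor 4].
Qed.

Lemma shifted_rowP z : 0 < a ->
  [\/ z < a.-1 /\ shifted_row z = inl z,
      a.-1 <= z < (a + h).-1 /\ shifted_row z = inr (z - a.-1),
      z = (a + h).-1 /\ shifted_row z = inl a.-1 |
      a + h <= z /\ shifted_row z = if z < a + h + h then inr (z - (a + h)) else inl (z - h.*2)].
Proof.
move=> a_gt0; rewrite /shifted_row; case: ltnP => ?; first by constructor 1.
case: ltnP => ?; first by constructor 2; split=> //; lia.
by case: eqP => ?; [constructor 3 | constructor 4; split=> //; lia].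
Qed.

Variable i : nat.
Let m := a + i.
Let n := a + i + h.*2.

Lemma row_nested : row m n nested_row nested_emb.
Proof.
rewrite /nested_row /nested_emb /m /n; split=> [x ltx|y x lty].
  case: (ltnP x a) => ?; first by rewrite ifT //; split=> //; lia.
  by do 3 (case: ifP => [?|_]; first by exfalso; lia); split; [lia | congr inl; lia].
case: ltnP => [? [<-]|?]; first by rewrite ifT //; lia.
do 2 case: ltnP => // ?; move=> [<-]; case: ifP => ?; lia.
Qed.

Lemma nested_row_labels t : (exists2 y, y < n & nested_row y = inr t) <-> t < h.
Proof.
rewrite /nested_row; split=> [[y lty]|ltt].
  by case: ltnP => // ?; case: ltnP => ?; [move=> [<-]; lia | case: ltnP => // ? [<-]; lia].
exists (a + t); first by rewrite /n; lia.
case: ifP => [?|_]; first by exfalso; lia.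
by case: ifP => [_|?]; [rewrite addKn | exfalso; lia].
Qed.

Lemma nested_row_pairs : pairs_row n nested_row.
Proof.
move=> y t lty; rewrite /nested_row; case: ltnP => // ?; case: ltnP => ?.
  case=> et; exists (y + h); split; try by rewrite /n in lty *; lia.
    do 2 (case: ifP => [?|_]; first by exfalso; lia).
    by case: ifP => [_|?]; [congr inr; lia | exfalso; lia].
  move=> z ltz; case: ltnP => // ?; case: ltnP => ?; first by case=> ez; lia.
  by case: ltnP => // ? [ez]; lia.
case: ltnP => // ? [et]; exists (y - h); split; try by rewrite /n in lty *; lia.
  case: ifP => [?|_]; first by exfalso; lia.
  by case: ifP => [_|?]; [congr inr; lia | exfalso; lia].
move=> z ltz; case: ltnP => // ?; case: ltnP => ?; first by case=> ez; lia.
by case: ltnP => // ? [ez]; lia.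
Qed.

Lemma wall_nested_row p : a = p + i -> wall_row p m n nested_row nested_emb.
Proof.
move=> ea; have halfn : p + (n - p)./2 = a + h by rewrite /n ea; lia.
have halfm : p + (m - p)./2 = a by rewrite /m ea; lia.
rewrite /wall_row halfn halfm; split; first exact: nested_row_pairs.
  by move=> x ltx; rewrite /nested_emb; case: (ltnP x a) => ?; lia.
move=> y y' t lty lty' ne; rewrite /nested_row.
case: ltnP => // ?; case: (ltnP y' a) => // ?.
case: (ltnP y) => ?; case: (ltnP y') => ? //=.
- by move=> [ey] [ey']; lia.
- by case: ltnP => // ? [ey]; case: ltnP => // ? [ey']; lia.
Qed.

Section Shifted.
Hypothesis a_gt0 : 0 < a.

Lemma row_shifted : row m n shifted_row shifted_emb.
Proof.
rewrite /shifted_row /shifted_emb /m /n; split=> [x ltx|y x lty].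
  case: (ltnP x a.-1) => ?; first by rewrite ifT //; split=> //; lia.
  case: eqP => [ex|nex].
    do 2 (case: ifP => [?|_]; first by exfalso; lia).
    by rewrite eqxx ex; split=> //; lia.
  do 2 (case: ifP => [?|_]; first by exfalso; lia).
  case: eqP => [?|_]; first by exfalso; lia.
  by case: ifP => [?|_]; [exfalso; lia | split; [lia | congr inl; lia]].
case: ltnP => [? [<-]|?]; first by rewrite ifT //; lia.
case: ltnP => // ?; case: eqP => [ey [<-]|ney]; first by rewrite ltnn eqxx; lia.
by case: ltnP => // ? [<-]; case: ifP => ?; [lia | case: eqP => ?; lia].
Qed.

Lemma shifted_row_pairs : pairs_row n shifted_row.
Proof.
have inrE z t : shifted_row z = inr t ->
    (z = a.-1 + t /\ t < h) \/ (z = a + h + t /\ t < h).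
  rewrite /shifted_row; case: ltnP => // ?; case: ltnP => ?; first by case=> ?; lia.
  by case: eqP => // ?; case: ltnP => // ? [?]; lia.
have lowE t : t < h -> shifted_row (a.-1 + t) = inr t.
  move=> ltt; rewrite /shifted_row ltn_nge_addr addKn.
  by case: ifP => // ?; exfalso; lia.
have highE t : t < h -> shifted_row (a + h + t) = inr t.
  move=> ltt; rewrite /shifted_row.
  do 2 (case: ifP => [?|_]; first by exfalso; lia).
  case: eqP => [?|_]; first by exfalso; lia.
  by case: ifP => [_|?]; [congr inr; lia | exfalso; lia].
move=> y t lty /inrE[] [-> ltt]; [exists (a + h + t) | exists (a.-1 + t)];
  (split; [rewrite /n; lia | lia | by auto | by move=> z _ /inrE; lia]).
Qed.

Lemma wall_shifted_row p : a = p + i -> wall_row p m n shifted_row shifted_emb.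
Proof.
move=> ea; have halfn : p + (n - p)./2 = a + h by rewrite /n ea; lia.
have halfm : p + (m - p)./2 = a by rewrite /m ea; lia.
rewrite /wall_row halfn halfm; split; first exact: shifted_row_pairs.
  move=> x ltx; rewrite /shifted_emb; case: (ltnP x a.-1) => ?; first lia.
  by case: eqP => ?; lia.
move=> y y' t lty lty' ne; rewrite /shifted_row.
case: ltnP => // ?; case: (ltnP y' a.-1) => // ?.
case: (ltnP y) => ?; case: (ltnP y' (a + h).-1) => ?.
- by move=> [ey] [ey']; lia.
- by move=> [ey]; case: eqP => // ?; case: ltnP => // ? [ey']; lia.
- by case: eqP => // ?; case: ltnP => // ? [ey] [ey']; lia.
by do 2 (case: eqP => // ?); case: ltnP => // ? [ey]; case: ltnP => // ? [ey']; lia.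
Qed.

(** The arc ending at [a + h + t] starts at [a + t] in one row and at [a.-1 + t] in the other.
    Together the arcs form one path from [a.-1] to [(a + h).-1], the two places of the last left
    strand. *)
Lemma compatible_shifted : compatible m n 0 nested_row shifted_row shifted_comp.
Proof.
split.
- move=> y y' lty lty' []; rewrite /shifted_comp /n in lty lty' *.
    by case: (nested_rowP y) => -[? ->]; case: (nested_rowP y') => -[? ->] // [e];
      congr inl; do ?[case: ifP => ?]; lia.
  case: (shifted_rowP y a_gt0) => -[? ->]; case: (shifted_rowP y' a_gt0) => -[? ->] //;
    try (case: (ltnP y (a + h + h)) => ? //); try (case: (ltnP y' (a + h + h)) => ? //);
    first [move=> [e] | move=> _]; congr inl; do ?[case: ifP => ?]; lia.
- move=> y x lty []; rewrite /shifted_comp.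
    by case: (nested_rowP y) => -[? ->] // [<-]; congr inl; do ?[case: ifP => ?]; lia.
  case: (shifted_rowP y a_gt0) => -[? ->] //; try (case: (ltnP y (a + h + h)) => ? //);
    by move=> [<-]; congr inl; do ?[case: ifP => ?]; lia.
- by move=> y x lty [<-]; rewrite /m /n in lty *; do ?[case: ifP => ?]; lia.
- move=> T c c_nest c_shift.
  have c_right t : t < h -> c (a + h + t) = c (a.-1 + t).
    move=> ltt; apply: c_shift; rewrite /n; try lia.
    case: (shifted_rowP (a + h + t) a_gt0) => -[? ->]; try (by exfalso; lia);
      case: (shifted_rowP (a.-1 + t) a_gt0) => -[? ->]; try (by exfalso; lia).
    by rewrite ifT; [congr inr; lia | lia].
  have c_next t : t < h -> c (a + h + t) = c (a + t).
    move=> ltt; apply: c_nest; rewrite /n; try lia.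
    by case: (nested_rowP (a + h + t)) => -[? ->]; try (by exfalso; lia);
      case: (nested_rowP (a + t)) => -[? ->]; try (by exfalso; lia); congr inr; lia.
  (* The passage from [a.-1 + j] to [a + j] goes across the wall, through [a + h + j]. *)
  have c_left j : j <= h -> c (a.-1 + j) = c a.-1.
    elim: j => [|j IHj] lej; first by rewrite addn0.
    by rewrite -(IHj (ltnW lej)) -(c_right j) // c_next //; congr c; lia.
  have c_mid y : a.-1 <= y -> y < a + h + h -> c y = c a.-1.
    move=> ley lty; case: (ltnP y (a + h)) => ltyh.
      by rewrite -(subnKC ley) c_left //; lia.
    by rewrite -(subnKC ltyh) c_right ?c_left //; lia.
  move=> y y' lty lty' [].
  case: (ltnP y a.-1) => ?; case: (ltnP y' a.-1) => ?.
  + by move=> ->.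
  + by case: ifP => ?; lia.
  + by case: ifP => ?; lia.
  case: (ltnP y (a + h + h)) => ?; case: (ltnP y' (a + h + h)) => ? e; try lia.
  + by rewrite !c_mid.
  + by congr c; lia.
by move=> t; split=> // -[].
Qed.

End Shifted.
End WalledRows.

Lemma nested_row0 a y : nested_row a 0 y = inl y.
Proof.
by case: (nested_rowP a 0 y) => -[? ->] //; try (by exfalso; lia); congr inl; lia.
Qed.

Lemma shifted_row0 a y : 0 < a -> shifted_row a 0 y = inl y.
Proof.
move=> a_gt0; case: (shifted_rowP 0 y a_gt0) => -[? ->] //; try (by exfalso; lia).
  by congr inl; lia.
by case: ifP => ?; [exfalso; lia | congr inl; lia].
Qed.

Lemma good_rows_walled (K : fieldType) (delta : K) (n p : nat) :
  (delta != 0)%R || (p != 0) ->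
  good_rows delta (p + n.*2) (objs_walled p n) (wall_row p).
Proof.
have par m : m \in objs_walled p n ->
    exists i h, [/\ m = (p + i) + i, p + n.*2 = (p + i) + i + h.*2 & n = i + h].
  by case/mapP=> i; rewrite mem_iota => lei ->; exists i, (n - i); split; lia.
pose i_ m := (m - p)./2; pose h_ m := n - i_ m.
have ihE i h : n = i + h -> i_ (p + i + i) = i /\ h_ (p + i + i) = h.
  by rewrite /h_ /i_ => ->; split; lia.
have nE : i_ (p + n.*2) = n /\ h_ (p + n.*2) = 0 by rewrite /h_ /i_; split; lia.
case/orP=> [d_neq0|p_neq0].
  exists (fun m => nested_row (p + i_ m) (h_ m)), (fun m => nested_row (p + i_ m) (h_ m)),
    (fun m => nested_row (p + i_ m) (h_ m)), (fun m => nested_emb (p + i_ m) (h_ m)),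
    (fun m => nested_emb (p + i_ m) (h_ m)), h_.
  split.
  - by move=> m /par[i [h [-> -> /ihE[-> ->]]]]; split; apply: row_nested.
  - move=> m /par[i [h [-> -> /ihE[-> ->]]]].
    exact: compatible_diag (row_nested _ _ _) (nested_row_labels _ _ _).
  - by move=> m /par[i [h [-> -> /ihE[-> ->]]]]; split; apply: wall_nested_row.
  - by move=> m _; rewrite expf_neq0.
  case: nE => -> ->; split=> // y lty; exact: nested_row0.
exists (fun m => nested_row (p + i_ m) (h_ m)), (fun m => shifted_row (p + i_ m) (h_ m)),
  (fun m => shifted_comp (p + i_ m) (h_ m)), (fun m => nested_emb (p + i_ m) (h_ m)),
  (fun m => shifted_emb (p + i_ m) (h_ m)), (fun=> 0).
(* For [p] nonzero every object has a strand left of the wall. *)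
have gt0 i : 0 < p + i by lia.
split.
- by move=> m /par[i [h [-> -> /ihE[-> ->]]]]; split; [apply: row_nested | apply: row_shifted].
- by move=> m /par[i [h [-> -> /ihE[-> ->]]]]; apply: compatible_shifted.
- by move=> m /par[i [h [-> -> /ihE[-> ->]]]]; split;
    [apply: wall_nested_row | apply: wall_shifted_row].
- by move=> m _; rewrite expr0 oner_neq0.
case: nE => -> ->; split=> // y lty.
  exact: nested_row0.
by apply: shifted_row0; lia.
Qed.

(** * The five families of diagrams *)

Theorem theorem8p10 (K : fieldType) (delta : K) (n p : nat) :
  [/\ (1 < n -> delta != 0%R -> morita_equiv (Palg delta n) (Pcat_le delta n)),
      (1 < n -> (delta != 0%R) || odd n -> morita_equiv (Balg delta n) (Bcat_le delta n)),
      (1 < n -> (delta != 0%R) || odd n -> morita_equiv (Jalg delta n) (Jcat_le delta n)),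
      (1 < n -> (delta != 0%R) || odd n -> morita_equiv (TLalg delta n) (TLcat_le delta n)) &
      (0 < n -> (delta != 0%R) || (p != 0) ->
         morita_equiv (WBalg delta (p + n) n) (WBcat_le delta p n))].
Proof.
have par_n : n \in objs_par n by apply/mapP; exists 0; rewrite ?mem_iota; lia.
have par_le m : m \in objs_par n -> m <= n by case/mapP=> i _ ->; lia.
have leNN m m' : m \in objs_par n -> m' \in objs_par n -> m + m' <= n.*2.
  by move=> /par_le ? /par_le ?; lia.
split=> [_ d_neq0|_ cond|_ cond|_ cond|_ cond].
- apply: (@cat_alg_morita _ _ _ _ _ (fun _ _ _ _ => True)) (good_rows_le n d_neq0) => //.
    by rewrite mem_iota; lia.
  by move=> m; rewrite mem_iota; lia.
- apply: (@cat_alg_morita _ _ _ _ (@brauer_allowed) planar_row par_n par_le _ _ _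
    (good_rows_par cond)).
  + by move=> m _; apply: planar_row_id.
  + by move=> m om; apply: brauerb_idpart; apply: leNN.
  + move=> m m' l l' d e phi phi' P om om' ol ol' rd re pd pe dP.
    exact: (brauer_ext_planar rd re pd pe dP (leNN _ _ om om') (leNN _ _ ol ol')).
- apply: (@cat_alg_morita _ _ _ _ (@jones_allowed) planar_row par_n par_le _ _ _
    (good_rows_par cond)).
  + by move=> m _; apply: planar_row_id.
  + by move=> m om; apply: jonesb_idpart; apply: leNN.
  + move=> m m' l l' d e phi phi' P om om' ol ol' rd re pd pe dP.
    exact: (jonesb_ext rd re pd pe dP (leNN _ _ om om') (leNN _ _ ol ol')).
- apply: (@cat_alg_morita _ _ _ _ (@tl_allowed) planar_row par_n par_le _ _ _
    (good_rows_par cond)).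
  + by move=> m _; apply: planar_row_id.
  + by move=> m om; apply: tlb_idpart; apply: leNN.
  + move=> m m' l l' d e phi phi' P om om' ol ol' rd re pd pe dP.
    exact: (tlb_ext rd re pd pe dP (leNN _ _ om om') (leNN _ _ ol ol')).
have w_le m : m \in objs_walled p n -> m <= p + n.*2.
  by case/mapP=> i; rewrite mem_iota => lei ->; lia.
have wNN m m' : m \in objs_walled p n -> m' \in objs_walled p n -> m + m' <= (p + n.*2).*2.
  by move=> /w_le ? /w_le ?; lia.
rewrite /WBalg /WBcat_le addnK -addnA addnn.
have w_n : p + n.*2 \in objs_walled p n by apply/mapP; exists n; rewrite ?mem_iota; lia.
apply: (@cat_alg_morita _ _ _ _ (walled_allowed p) (wall_row p) w_n w_le _ _ _
  (good_rows_walled n cond)).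
- by move=> m _; apply: wall_row_id.
- by move=> m om; apply: walledb_idpart; apply: wNN.
- move=> m m' l l' d e phi phi' P om om' ol ol' rd re [pd hd wd] [pe he we] dP.
  exact: (walledb_ext rd re dP (wNN _ _ om om') (wNN _ _ ol ol') pd pe hd he wd we).
Qed.
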